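(* Let $\Lambda$ be an artin algebra and let $X \subset Y$ be a Gabriel-Roiter inclusion of $\Lambda$-modules of finite length. Then there exist an indecomposable $\Lambda$-module $M$ of finite length, an irreducible monomorphism $X \to M$ and an epimorphism $M \to Y$ such that the composition $X \to M \to Y$ is injective (and therefore also a Gabriel-Roiter inclusion).
   Context: All modules are $\Lambda$-modules of finite length, and $|M|$ denotes the length of $M$. The Gabriel-Roiter measure $\mu(M)$ is the rational number defined inductively by: $\mu(0)=0$; if $M\neq 0$ is decomposable, $\mu(M)=\max\mu(M')$ over proper submodules $M'$ of $M$; if $M$ is indecomposable, $\mu(M)=2^{-|M|}+\max_{M'\subset M}\mu(M')$, the maximum being over proper submodules $M'$ of $M$. For $Y$ indecomposable and not simple, a Gabriel-Roiter submodule of $Y$ is an indecomposable proper submodule $X\subset Y$ with $\mu(Y)-\mu(X)=2^{-|Y|}$; the inclusion $X\subset Y$ is then called a Gabriel-Roiter inclusion. More generally, a monomorphism $X\to Y$ is called a Gabriel-Roiter inclusion if its image is a Gabriel-Roiter submodule of $Y$. A map $h$ is irreducible if it is neither a split monomorphism nor a split epimorphism and whenever $h=h''h'$, then $h'$ is a split monomorphism or $h''$ is a split epimorphism. *)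

(* Defs.v *)
From HB Require Import structures.
From mathcomp Require Import all_boot all_order all_algebra.
From mathcomp Require Import boolp classical_sets functions.

Set Implicit Arguments.
Unset Strict Implicit.
Unset Printing Implicit Defensive.

Import Order.TTheory GRing.Theory Num.Theory.

Local Open Scope classical_set_scope.
Local Open Scope ring_scope.

(* A submodule of [M] is a set [U : set M] closed under the operations.  The
   submodules of [U], seen as a module of its own, are the submodules of [M]
   contained in [U]; so length, indecomposability, simplicity and the
   Gabriel-Roiter measure are defined for submodules [U] of an ambient module,
   and the module [M] itself is the case [U = [set: M]]. *)
Definition submodule (R : pzRingType) (M : lmodType R) (U : set M) : Prop :=
  GRing.submod_closed [in U].

Definition proper_submodule (R : pzRingType) (M : lmodType R) (V U : set M) :
    Prop :=
  submodule V /\ V `<` U.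

(* Junk value [x0] when [A] has no greatest element. *)
Definition max_set (d : Order.disp_t) (T : porderType d) (x0 : T)
    (A : set T) : T :=
  xget x0 (A `&` ubound A).

Definition submodule_chain (R : pzRingType) (M : lmodType R) (U : set M)
    (n : nat) (c : nat -> set M) : Prop :=
  (forall i, (i <= n)%N -> submodule (c i) /\ c i `<=` U) /\
  (forall i, (i < n)%N -> c i `<` c i.+1).

Definition chain_lengths (R : pzRingType) (M : lmodType R) (U : set M) :
    set nat :=
  [set n | exists c, submodule_chain U n c].

(* |U|, the largest number of strict inclusions in a chain of submodules. *)
Definition mod_length (R : pzRingType) (M : lmodType R) (U : set M) : nat :=
  max_set 0%N (chain_lengths U).

Definition finite_length (R : pzRingType) (M : lmodType R) : Prop :=
  has_ubound (chain_lengths [set: M]).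

Definition indecomposable (R : pzRingType) (M : lmodType R) (U : set M) :
    Prop :=
  U <> [set 0] /\
  forall V W : set M, submodule V -> submodule W -> V `<=` U -> W `<=` U ->
    V `&` W = [set 0] -> U = [set v + w | v in V & w in W] ->
    V = [set 0] \/ W = [set 0].

Definition simple_module (R : pzRingType) (M : lmodType R) (U : set M) :
    Prop :=
  U <> [set 0] /\ forall V : set M, proper_submodule V U -> V = [set 0].

Fixpoint gr_rec (R : pzRingType) (M : lmodType R) (n : nat) (U : set M) : rat :=
  if n is n'.+1 then
    if `[< U = [set 0] >] then 0 else
    (if `[< indecomposable U >] then 2 ^- mod_length U else 0) +
    max_set 0 [set gr_rec n' V | V in [set V | proper_submodule V U]]
  else 0.

(* Proper submodules have smaller length, so [mod_length U] levels of recursion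
   suffice: see [gr_measureE] and [gr_measure_max]. *)
Definition gr_measure (R : pzRingType) (M : lmodType R) (U : set M) : rat :=
  gr_rec (mod_length U) U.

Lemma max_set_nat (A : set nat) : A !=set0 -> has_ubound A ->
  A (max_set 0%N A) /\ ubound A (max_set 0%N A).
Proof.
move=> [a Aa] [N ubN]; rewrite /max_set; case: xgetP => [y _ []//|nomax].
have exA : exists n, `[< A n >] by exists a; apply/asboolP.
have ubA i : `[< A i >] -> (i <= N)%N by move=> /asboolP /ubN.
case: (ex_maxnP exA ubA) => m /asboolP Am leAm.
case: (nomax m); split => // i Ai.
by apply: leAm; apply/asboolP.
Qed.

Lemma chain_lengths_sub (R : pzRingType) (M : lmodType R) (V U : set M) :
  V `<=` U -> chain_lengths V `<=` chain_lengths U.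
Proof.
move=> VU n [c [cV clt]]; exists c; split => // i /cV[ci ciV].
by split=> //; exact: subset_trans VU.
Qed.

Lemma mod_length_max (R : pzRingType) (M : lmodType R) (U : set M) :
  submodule U -> has_ubound (chain_lengths U) ->
  chain_lengths U (mod_length U) /\ ubound (chain_lengths U) (mod_length U).
Proof.
move=> sU fU; apply: max_set_nat => //; exists 0%N; exists (fun=> U).
by split=> // i _; split.
Qed.

Lemma mod_length_lt (R : pzRingType) (M : lmodType R) (V U : set M) :
  submodule U -> has_ubound (chain_lengths U) -> proper_submodule V U ->
  (mod_length V < mod_length U)%N.
Proof.
move=> sU fU [sV ltVU]; have [VU nUV] := ltVU.
have fV : has_ubound (chain_lengths V).
  by apply: subset_has_ubound fU; exact: chain_lengths_sub.
have [[c [cV clt]] _] := mod_length_max sV fV.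
have [_] := mod_length_max sU fU; apply.
exists (fun i => if (i <= mod_length V)%N then c i else U); split => i lei.
  by case: ifP => [/cV[ci ciV]|_]; split=> //; exact: subset_trans VU.
rewrite ltnS in lei; rewrite lei; case: ifP => [/clt//|_].
have ci : c i `<=` V by have [] := cV _ lei.
split=> [|Uci]; first exact: subset_trans VU.
by apply: nUV; exact: subset_trans Uci ci.
Qed.

Lemma submodule0 (R : pzRingType) (M : lmodType R) :
  submodule [set 0 : M].
Proof.
split=> [|a u v]; rewrite !inE //.
by move=> -> ->; rewrite scaler0 addr0.
Qed.

Lemma proper_submodule0 (R : pzRingType) (M : lmodType R) (U : set M) :
  submodule U -> U <> [set 0] -> proper_submodule [set 0] U.
Proof.
move=> sU U0; split; first exact: submodule0.
have sub0U : [set 0 : M] `<=` U.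
  by move=> _ ->; have [+ _] := sU; rewrite !inE.
by split=> // U_sub0; apply: U0; apply/seteqP.
Qed.

Lemma mod_length_gt0 (R : pzRingType) (M : lmodType R) (U : set M) :
  submodule U -> has_ubound (chain_lengths U) -> U <> [set 0] ->
  (0 < mod_length U)%N.
Proof.
move=> sU fU U0; apply: leq_ltn_trans (leq0n _) (mod_length_lt sU fU _).
exact: proper_submodule0.
Qed.

Lemma gr_rec_stable (R : pzRingType) (M : lmodType R) (n m : nat) (U : set M) :
  submodule U -> has_ubound (chain_lengths U) ->
  (mod_length U <= n)%N -> (mod_length U <= m)%N -> gr_rec n U = gr_rec m U.
Proof.
elim: n m U => [|n IHn] [|m] U sU fU //=.
- move=> len _; case: asboolP => // /(mod_length_gt0 sU fU).
  by rewrite ltnNge len.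
- move=> _ lem; case: asboolP => // /(mod_length_gt0 sU fU).
  by rewrite ltnNge lem.
move=> len lem; case: asboolP => // _; congr (_ + max_set _ _).
apply: eq_imagel => V VU; have ltVU := mod_length_lt sU fU VU.
case: VU => sV [VU _]; apply: IHn => //.
- by apply: subset_has_ubound fU; exact: chain_lengths_sub.
- by rewrite -ltnS; exact: leq_trans len.
- by rewrite -ltnS; exact: leq_trans lem.
Qed.

Lemma gr_measure0 (R : pzRingType) (M : lmodType R) :
  gr_measure [set 0 : M] = 0.
Proof. by rewrite /gr_measure; case: mod_length => //= n; rewrite asboolT. Qed.

Lemma gr_measureE (R : pzRingType) (M : lmodType R) (U : set M) :
  submodule U -> has_ubound (chain_lengths U) -> U <> [set 0] ->
  gr_measure U =
    (if `[< indecomposable U >] then 2 ^- mod_length U else 0) +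
    max_set 0 [set gr_measure V | V in [set V | proper_submodule V U]].
Proof.
move=> sU fU U0; have Upos := mod_length_gt0 sU fU U0.
rewrite {1}/gr_measure; case El: (mod_length U) Upos => [//|l] _ /=.
rewrite asboolF // El; congr (_ + max_set _ _); apply: eq_imagel => V VU.
have ltVU := mod_length_lt sU fU VU; case: VU => sV [VU _].
apply: gr_rec_stable => //; last by rewrite -ltnS -El.
by apply: subset_has_ubound fU; exact: chain_lengths_sub.
Qed.

Lemma gr_rec_dyadic (R : pzRingType) (M : lmodType R) (l n : nat) (U : set M) :
  submodule U -> has_ubound (chain_lengths U) -> (mod_length U <= l)%N ->
  exists2 a : nat, (a <= n * 2 ^ l)%N & gr_rec n U = a%:R / 2 ^+ l.
Proof.
elim: n U => [|n IHn] U sU fU lel /=; first by exists 0%N; rewrite ?mul0r.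
case: asboolP => _; first by exists 0%N; rewrite ?mul0r.
set A := image _ _.
have [a lea ->] : exists2 a : nat,
    (a <= n * 2 ^ l)%N & max_set 0 A = a%:R / 2 ^+ l.
  rewrite /max_set; case: xgetP => [_ _ [[V VU <-] _]|_].
    have ltVU := mod_length_lt sU fU VU; case: VU => sV [VU _].
    apply: IHn => //; last exact: leq_trans (ltnW ltVU) lel.
    by apply: subset_has_ubound fU; exact: chain_lengths_sub.
  by exists 0%N; rewrite ?mul0r.
case: asboolP => _; last first.
  by exists a; rewrite ?add0r// mulSn (leq_trans lea) ?leq_addl.
exists (2 ^ (l - mod_length U) + a)%N.
  by rewrite mulSn leq_add // leq_exp2l // leq_subr.
rewrite natrD mulrDl natrX; congr (_ + _); apply/eqP.
rewrite -[X in _ / 2 ^+ X](subnK lel) exprD invfM mulrA divff ?mul1r //.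
by rewrite expf_neq0.
Qed.

Lemma gr_measure_max (R : pzRingType) (M : lmodType R) (U : set M) :
  submodule U -> has_ubound (chain_lengths U) -> U <> [set 0] ->
  let A := [set gr_measure V | V in [set V | proper_submodule V U]] in
  A (max_set 0 A) /\ ubound A (max_set 0 A).
Proof.
move=> sU fU U0 A; set l := mod_length U.
pose B : set nat := [set a | A (a%:R / 2 ^+ l)].
have AB q : A q -> exists2 a : nat, (a <= l * 2 ^ l)%N & q = a%:R / 2 ^+ l.
  move=> [V VU <-]; have ltVU := mod_length_lt sU fU VU.
  case: VU => sV [VU _].
  have fV : has_ubound (chain_lengths V).
    by apply: subset_has_ubound fU; exact: chain_lengths_sub.
  rewrite /gr_measure.
  have [a lea ->] := gr_rec_dyadic (mod_length V) sV fV (ltnW ltVU).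
  by exists a => //; apply: leq_trans lea _; rewrite leq_mul2r ltnW ?orbT.
have p2 : 0 < (2 ^+ l)^-1 :> rat by rewrite invr_gt0 exprn_gt0.
have [] : B (max_set 0%N B) /\ ubound B (max_set 0%N B).
  apply: max_set_nat.
    have A0 : A 0.
      by exists [set 0]; [exact: proper_submodule0 | exact: gr_measure0].
    by exists 0%N; rewrite /B /= mul0r.
  exists (l * 2 ^ l)%N => b /AB[a lea] /(mulIf (lt0r_neq0 p2)) /eqP.
  by rewrite eqr_nat => /eqP ->.
set b := max_set 0%N B => Bb ubb.
rewrite /max_set; case: xgetP => [q _ []//|/(_ (b%:R / 2 ^+ l))[]].
split=> // q Aq; have [a lea Ea] := AB q Aq.
by rewrite Ea ler_pM2r // ler_nat; apply: ubb; rewrite /B /= -Ea.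
Qed.

Definition gr_submodule (R : pzRingType) (Y : lmodType R) (X : set Y) : Prop :=
  [/\ indecomposable [set: Y], ~ simple_module [set: Y],
      proper_submodule X [set: Y], indecomposable X &
      gr_measure [set: Y] - gr_measure X = 2 ^- mod_length [set: Y]].

Definition gr_inclusion (R : pzRingType) (X Y : lmodType R)
    (f : {linear X -> Y}) : Prop :=
  injective f /\ gr_submodule (range f).

Definition split_mono (R : pzRingType) (X Y : lmodType R)
    (f : {linear X -> Y}) : Prop :=
  exists r : {linear Y -> X}, cancel f r.

Definition split_epi (R : pzRingType) (X Y : lmodType R)
    (f : {linear X -> Y}) : Prop :=
  exists s : {linear Y -> X}, cancel s f.

(* Irreducibility in the category of modules of finite length. *)
Definition irreducible_map (R : pzRingType) (X Y : lmodType R)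
    (h : {linear X -> Y}) : Prop :=
  [/\ ~ split_mono h, ~ split_epi h &
      forall (Z : lmodType R) (h' : {linear X -> Z}) (h'' : {linear Z -> Y}),
        finite_length Z -> h =1 h'' \o h' -> split_mono h' \/ split_epi h''].

(* The submodules of [k^o] are the ideals of [k]. *)
Definition artinian (k : comPzRingType) : Prop :=
  forall I : nat -> set k^o,
    (forall n, submodule (I n)) -> (forall n, I n.+1 `<=` I n) ->
    exists N, forall n, (N <= n)%N -> I n = I N.

Definition finitely_generated (R : pzRingType) (M : lmodType R) : Prop :=
  exists (n : nat) (e : 'I_n -> M),
    forall x, exists a : 'I_n -> R, x = \sum_(i < n) a i *: e i.

Definition artin_algebra (k : comPzRingType) (L : algType k) : Prop :=
  artinian k /\ finitely_generated L.

(* Main.v *)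
Require Import Defs.
From HB Require Import structures.
From mathcomp Require Import all_boot all_order all_algebra.
From mathcomp Require Import boolp classical_sets functions.

Set Implicit Arguments.
Unset Strict Implicit.
Unset Printing Implicit Defensive.

Import Order.TTheory GRing.Theory Num.Theory.

Local Open Scope classical_set_scope.
Local Open Scope ring_scope.

(* A nonsplit map out of the indecomposable [X] factors through a left almost
   split map [e : X -> E] with [E] of finite length.  Dualizing over [k], the
   dual of [X] has generators [xi_j] with a finite matrix [r] of relations over
   [L], and there are [q_j] in [X] such that [s |-> sum_j xi_j (s q_j)] is zero
   on the radical of [End X] but not at [1].  For nonsplit [f : X -> Z] every
   endomorphism [h \o f] lies in the radical; by duality this says that [f q]
   is of the form [r z] for some tuple [z] in [Z], and [E] is the universal
   module under [X] in which [q] acquires that form.  When [E] has minimal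
   length, the components of [e] on direct summands are irreducible.

   Write the Gabriel-Roiter inclusion as [h \o e].  By Gabriel's main property
   a sum of two noninjective maps [X -> Y] is noninjective, so some
   indecomposable summand [M] of [E] carries an injective component
   [X -> M -> Y]; and [M -> Y] is onto, because a monomorphism from [X] into a
   proper submodule of [Y] splits. *)

(** * Submodules and quotients as modules *)

(** The base [k] is an arbitrary commutative artinian ring, so the dualizing module is built from
    lengths alone: [J] has greatest length among the [k]-modules whose socle contains each simple
    module at most once. Such modules are no longer than [k], and maximality makes [J] separate
    points of modules of finite length, with only scalars as endomorphisms.

    Why [f] splits if [f q] is not of the form [r z]: some [zeta : Z^m -> J] kills all [r z] but not
    [f q]. Killing them means that the components of [zeta] satisfy every relation of the [xi_j], so
    [zeta_j = xi_j \o h] for an [L]-linear [h : Z -> X]. Then [\sum_j xi_j (h (f q_j))] is nonzero,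
    so [h \o f] is outside the radical, hence invertible.

    The summand [M] is the image, of least length, of an idempotent of [E] through which the
    component stays injective; decomposing it further would contradict minimality. *)

Definition linear_map (R : pzRingType) (U V : lmodType R) (f : U -> V)
    (lf : linear f) : {linear U -> V} :=
  HB.pack f (GRing.isLinear.Build R U V *:%R f lf).

Section Submodules.
Variables (R : pzRingType) (M : lmodType R).
Implicit Types (U V W : set M).

Lemma submoduleP U :
  submodule U <-> U 0 /\ forall a u v, U u -> U v -> U (a *: u + v).
Proof.
rewrite /submodule; split=> -[U0 UD]; split.
- by move: U0; rewrite inE.
- by move=> a u v Uu Uv; have := UD a u v; rewrite !inE; apply.
- by rewrite inE.
- by move=> a u v; rewrite !inE; exact: UD.
Qed.

Lemma submod0 U : submodule U -> U 0.
Proof. by move=> /submoduleP[]. Qed.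

Lemma submodZ U a x : submodule U -> U x -> U (a *: x).
Proof.
by move=> /submoduleP[U0 UD] Ux; rewrite -[_ *: _]addr0; exact: UD.
Qed.

Lemma submodD U x y : submodule U -> U x -> U y -> U (x + y).
Proof.
by move=> /submoduleP[U0 UD] Ux Uy; rewrite -[x]scale1r; exact: UD.
Qed.

Lemma submodN U x : submodule U -> U x -> U (- x).
Proof. by move=> sU Ux; rewrite -scaleN1r; exact: submodZ. Qed.

Lemma submodB U x y : submodule U -> U x -> U y -> U (x - y).
Proof. by move=> sU Ux Uy; apply: submodD => //; exact: submodN. Qed.

Lemma submod_sum U (I : Type) (r : seq I) (P : pred I) (F : I -> M) :
  submodule U -> (forall i, P i -> U (F i)) -> U (\sum_(i <- r | P i) F i).
Proof.
move=> sU UF; apply: (big_ind U) => //; first exact: submod0.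
by move=> x y; exact: submodD.
Qed.

Lemma submoduleT : submodule [set: M].
Proof. exact/submoduleP. Qed.

Lemma submoduleI U V : submodule U -> submodule V -> submodule (U `&` V).
Proof.
move=> /submoduleP[U0 UD] /submoduleP[V0 VD]; apply/submoduleP.
by split=> // a u v [Uu Vu] [Uv Vv]; split; [exact: UD | exact: VD].
Qed.

Definition sum_set U V : set M := [set v + w | v in U & w in V].

Lemma submodule_sum U V : submodule U -> submodule V -> submodule (sum_set U V).
Proof.
move=> /submoduleP[U0 UD] /submoduleP[V0 VD]; apply/submoduleP; split.
  by exists 0 => //; exists 0 => //; rewrite addr0.
move=> a _ _ [u Uu [v Vv <-]] [u' Uu' [v' Vv' <-]].
exists (a *: u + u'); first exact: UD.
exists (a *: v + v'); first exact: VD.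
by rewrite scalerDr addrACA.
Qed.

Lemma sum_setl U V : submodule V -> U `<=` sum_set U V.
Proof. by move=> /submod0 V0 u Uu; exists u => //; exists 0; rewrite ?addr0. Qed.

Lemma sum_setr U V : submodule U -> V `<=` sum_set U V.
Proof. by move=> /submod0 U0 u Uu; exists 0 => //; exists u; rewrite ?add0r. Qed.

Lemma sum_set_sub U V W :
  submodule W -> U `<=` W -> V `<=` W -> sum_set U V `<=` W.
Proof.
by move=> sW UW VW _ [u /UW Wu [v /VW Wv <-]]; exact: submodD.
Qed.

Definition line (x : M) : set M := range (fun a : R => a *: x).

Lemma submodule_line x : submodule (line x).
Proof.
apply/submoduleP; split=> [|a _ _ [b _ <-] [c _ <-]].
  by exists 0; rewrite ?scale0r.
by exists (a * b + c); rewrite // scalerDl scalerA.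
Qed.

Lemma line_id x : line x x.
Proof. by exists 1; rewrite ?scale1r. Qed.

Lemma line_sub U x : submodule U -> U x -> line x `<=` U.
Proof. by move=> sU Ux _ [a _ <-]; exact: submodZ. Qed.

End Submodules.

Section LinearMaps.
Variables (R : pzRingType) (M N : lmodType R).
Implicit Types (U : set M).

Lemma submodule_image U (f : {linear M -> N}) :
  submodule U -> submodule (f @` U).
Proof.
move=> /submoduleP[U0 UD]; apply/submoduleP; split.
  by exists 0; rewrite ?linear0.
by move=> a _ _ [x Ux <-] [y Uy <-]; exists (a *: x + y);
  [exact: UD | rewrite linearP].
Qed.

Lemma submodule_preimage (V : set N) (f : {linear M -> N}) :
  submodule V -> submodule (f @^-1` V).
Proof.
move=> /submoduleP[V0 VD]; apply/submoduleP; split; first by rewrite /= linear0.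
by move=> a u v /= Vu Vv; rewrite linearP; exact: VD.
Qed.

Definition ker (f : M -> N) : set M := f @^-1` [set 0].

Lemma submodule_ker (f : {linear M -> N}) : submodule (ker f).
Proof. exact/submodule_preimage/submodule0. Qed.

Lemma ker0_inj (f : {linear M -> N}) : ker f `<=` [set 0] -> injective f.
Proof.
move=> kf x y /eqP; rewrite -subr_eq0 -linearB => /eqP /kf /eqP.
by rewrite subr_eq0 => /eqP.
Qed.

Lemma set0_neq U : submodule U -> U <> [set 0] -> exists2 x, U x & x != 0.
Proof.
move=> sU U0; apply: contrapT => nex; apply: U0; apply/seteqP; split.
  move=> x Ux; apply/eqP; apply: contrapT => /negP x0.
  by apply: nex; exists x.
by move=> _ ->; exact: submod0.
Qed.

End LinearMaps.

Lemma submodule_range (R : pzRingType) (M N : lmodType R)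
  (f : {linear M -> N}) : submodule (range f).
Proof. exact/submodule_image/submoduleT. Qed.

Section Subtype.
Variables (R : pzRingType) (M : lmodType R) (U : set M) (sU : submodule U).

Definition submod_type (_ : submodule U) : Type := {x : M | x \in U}.
Local Notation T := (submod_type sU).

HB.instance Definition _ := [isSub of T for @sval M [in U]].
HB.instance Definition _ := [Choice of T by <:].
HB.instance Definition _ :=
  GRing.SubChoice_isSubLmodule.Build R M [in U] T
    (GRing.submod_closed_semi sU).

Definition submod_val : {linear T -> M} := linear_map (linearP (\val : T -> M)).

Lemma submod_val_inj : injective submod_val.
Proof. exact: val_inj. Qed.

Lemma range_submod_val : range submod_val = U.
Proof.
apply/seteqP; split=> [_ [x _ <-]|x Ux]; first exact/set_mem/(valP x).
by exists (exist _ x (mem_set Ux)).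
Qed.

Definition submod_in (x : M) (Ux : U x) : T := exist _ x (mem_set Ux).

Lemma submod_inK x Ux : submod_val (@submod_in x Ux) = x.
Proof. by []. Qed.

Lemma submod_valP x : U (submod_val x).
Proof. exact/set_mem/(valP x). Qed.

End Subtype.

Lemma linear_corestrict (R : pzRingType) (M N : lmodType R) (U : set M)
    (sU : submodule U) (f : {linear N -> M}) : (forall x, U (f x)) ->
  exists g : {linear N -> submod_type sU}, forall x, submod_val sU (g x) = f x.
Proof.
move=> Uf; have lg : linear (fun x => submod_in sU (Uf x)).
  move=> a x y; apply: (@submod_val_inj _ _ _ sU).
  by rewrite [RHS]linearP; exact: linearP.
by exists (linear_map lg).
Qed.

Section Quotient.
Import Quotient.
Variables (R : pzRingType) (M : lmodType R) (U : set M) (sU : submodule U).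

Definition quot_pred (_ : submodule U) : {pred M} := [in U].
Definition quot_closed : zmodClosed M := HB.pack_for (zmodClosed M)
  (quot_pred sU)
  (GRing.isZmodClosed.Build M (quot_pred sU) (GRing.submod_closedB sU)).
Definition quot_type := quot quot_closed.
HB.instance Definition _ := GRing.Zmodule.on quot_type.

Local Open Scope quotient_scope.

Definition quot_fun (x : M) : quot_type := \pi_(quot quot_closed) x.
Definition quot_repr (x : quot_type) : M := repr (x : quot quot_closed).

Lemma quot_reprK : cancel quot_repr quot_fun.
Proof. exact: reprK. Qed.

Lemma quot_eqP x y : quot_fun x = quot_fun y <-> U (x - y).
Proof.
split=> [/eqP|/mem_set Uxy].
  by rewrite -[_ == _]/(x == y %[mod quot _]) -idealrBE => /set_mem.
by apply/eqP; rewrite -[_ == _]/(x == y %[mod quot _]) -idealrBE.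
Qed.

Definition quot_scale (a : R) (x : quot_type) : quot_type :=
  quot_fun (a *: quot_repr x).

Lemma quot_funZ a x : quot_scale a (quot_fun x) = quot_fun (a *: x).
Proof.
apply/quot_eqP; rewrite -scalerBr; apply: submodZ => //.
by apply/quot_eqP; rewrite quot_reprK.
Qed.

Lemma quot_funD x y : quot_fun (x + y) = quot_fun x + quot_fun y.
Proof. exact: pi_add. Qed.

Let scaleA a b x : quot_scale a (quot_scale b x) = quot_scale (a * b) x.
Proof. by rewrite -[x]quot_reprK !quot_funZ scalerA. Qed.
Let scale1 : left_id 1 quot_scale.
Proof. by move=> x; rewrite -[x]quot_reprK !quot_funZ scale1r. Qed.
Let scaleDr : right_distributive quot_scale +%R.
Proof.
move=> a x y; rewrite -[x]quot_reprK -[y]quot_reprK.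
by rewrite -quot_funD !quot_funZ scalerDr quot_funD.
Qed.
Let scaleDl x : {morph quot_scale^~ x : a b / a + b}.
Proof. by move=> a b; rewrite -[x]quot_reprK !quot_funZ scalerDl quot_funD. Qed.

HB.instance Definition _ := GRing.Zmodule_isLmodule.Build R quot_type
  scaleA scale1 scaleDr scaleDl.

Let pi_linear : linear quot_fun.
Proof. by move=> a x y; rewrite quot_funD -quot_funZ. Qed.

Definition quot_map : {linear M -> quot_type} := linear_map pi_linear.

Lemma quot_map_surj y : exists x, quot_map x = y.
Proof. by exists (quot_repr y); exact: quot_reprK. Qed.

Lemma quot_map0 x : quot_map x = 0 <-> U x.
Proof.
rewrite -[0](linear0 quot_map) -[x in U x]subr0; exact: quot_eqP.
Qed.

End Quotient.

Lemma quot_factor (R : pzRingType) (M N : lmodType R) (U : set M)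
    (sU : submodule U) (f : {linear M -> N}) : U `<=` ker f ->
  exists g : {linear quot_type sU -> N}, forall x, g (quot_map sU x) = f x.
Proof.
move=> Uf; pose g (y : quot_type sU) := f (quot_repr y).
have gE x : g (quot_map sU x) = f x.
  apply/eqP; rewrite -subr_eq0 -linearB; apply/eqP/Uf.
  by apply/quot_eqP; rewrite quot_reprK.
have lg : linear g.
  move=> a x y; have [x' <-] := quot_map_surj x.
  have [y' <-] := quot_map_surj y.
  by rewrite -linearP !gE linearP.
by exists (linear_map lg).
Qed.

Section Coordinates.
Variables (R : pzRingType) (M : lmodType R) (n : nat).

Definition coord_in (i : 'I_n) (x : M) : 'I_n -> M :=
  fun j => if j == i then x else 0.

Lemma coord_in_linear i : linear (coord_in i).
Proof.
move=> a x y; apply/funext => j.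
rewrite -[RHS]/(a *: coord_in i x j + coord_in i y j).
by rewrite /coord_in; case: eqP; rewrite ?scaler0 ?addr0.
Qed.

Lemma sum_coord_in (g : 'I_n -> M) : g = \sum_i coord_in i (g i).
Proof.
apply/funext => j; rewrite fct_sumE (bigD1 j) //= {1}/coord_in eqxx.
by rewrite big1 ?addr0// => i /negbTE; rewrite eq_sym /coord_in => ->.
Qed.

Lemma linear_coord_in (N : lmodType R) (f : {linear ('I_n -> M) -> N}) g :
  f g = \sum_i f (coord_in i (g i)).
Proof. by rewrite {1}(sum_coord_in g) linear_sum. Qed.

Definition coord_map (N : lmodType R) (f : {linear ('I_n -> M) -> N}) i :
    {linear M -> N} :=
  linear_map (linearP (f \o linear_map (coord_in_linear i))).

End Coordinates.

(** * Length *)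

Definition fl (R : pzRingType) (M : lmodType R) (U : set M) : Prop :=
  has_ubound (chain_lengths U).

Section Length.
Variables (R : pzRingType) (M : lmodType R).
Implicit Types (U V W : set M).

Lemma fl_sub V U : V `<=` U -> fl U -> fl V.
Proof. by move=> VU; apply: subset_has_ubound; exact: chain_lengths_sub. Qed.

Lemma flT U : finite_length M -> fl U.
Proof. exact: fl_sub. Qed.

Lemma ubound_fl U n : ubound (chain_lengths U) n -> fl U.
Proof. by exists n. Qed.

Lemma ubound_len U n :
  submodule U -> ubound (chain_lengths U) n -> (mod_length U <= n)%N.
Proof.
move=> sU Un; have [+ _] := mod_length_max sU (ubound_fl Un); exact: Un.
Qed.

Lemma len_le V U :
  submodule V -> submodule U -> fl U -> V `<=` U ->
  (mod_length V <= mod_length U)%N.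
Proof.
move=> sV sU fU VU; have [_ /(_ (mod_length V))] := mod_length_max sU fU; apply.
apply: (chain_lengths_sub VU).
by have [] := mod_length_max sV (fl_sub VU fU).
Qed.

Lemma len_eq V U :
  submodule V -> submodule U -> fl U -> V `<=` U ->
  (mod_length U <= mod_length V)%N -> V = U.
Proof.
move=> sV sU fU VU leUV; apply/seteqP; split=> //; apply: contrapT => nUV.
suff: (mod_length V < mod_length U)%N by rewrite ltnNge leUV.
exact: mod_length_lt.
Qed.

(** A chain of length [l] forces the rank [rho] of its last term to be at least [l]. The length
    estimates that follow come from choosing [rho] well. *)
Lemma ubound_chain (rho : set M -> nat) U n :
  (forall V W, submodule V -> submodule W -> W `<=` U -> V `<` W ->
    (rho V < rho W)%N) ->
  (forall V, submodule V -> V `<=` U -> (rho V <= n)%N) ->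
  ubound (chain_lengths U) n.
Proof.
move=> rholt rhole l [c [cU clt]].
suff lerho i : (i <= l)%N -> (i <= rho (c i))%N.
  have [sc cl] := cU l (leqnn l).
  exact: leq_trans (lerho l (leqnn l)) (rhole _ sc cl).
elim: i => // i IHi ltil; apply: leq_ltn_trans (IHi (ltnW ltil)) _.
have [si _] := cU i (ltnW ltil); have [sSi SiU] := cU i.+1 ltil.
by apply: rholt => //; exact: clt.
Qed.

Lemma len0 : mod_length [set 0 : M] = 0%N.
Proof.
apply/eqP; rewrite -leqn0; apply: ubound_len; first exact: submodule0.
apply: (@ubound_chain (fun=> 0%N)) => // V W sV sW W0 [_ nWV].
by exfalso; apply: nWV => _ /W0 ->; exact: submod0.
Qed.

Lemma fl0 : fl [set 0 : M].
Proof.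
apply: (@ubound_fl _ 0); apply: (@ubound_chain (fun=> 0%N)) => // V W sV sW W0.
by move=> [_ nWV]; exfalso; apply: nWV => _ /W0 ->; exact: submod0.
Qed.

Lemma exists_max_len (A : set (set M)) U :
  submodule U -> fl U -> A !=set0 ->
  (forall V, A V -> submodule V /\ V `<=` U) ->
  exists2 V, A V & forall W, A W -> V `<=` W -> W = V.
Proof.
move=> sU fU [V0 AV0] AU.
have exA : exists n, `[< exists2 V, A V & mod_length V = n >].
  by exists (mod_length V0); apply/asboolP; exists V0.
have ubA n : `[< exists2 V, A V & mod_length V = n >] -> (n <= mod_length U)%N.
  by move=> /asboolP[V /AU[sV VU] <-]; exact: len_le.
case: (ex_maxnP exA ubA) => n /asboolP[V AV Vn] maxn; exists V => // W AW VW.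
have [sV VU] := AU V AV; have [sW WU] := AU W AW.
apply/esym/len_eq => //; first exact: fl_sub fU.
by rewrite Vn; apply: maxn; apply/asboolP; exists W.
Qed.

Lemma exists_min_len (A : set (set M)) : A !=set0 ->
  exists2 V, A V & forall W, A W -> (mod_length V <= mod_length W)%N.
Proof.
move=> [V0 AV0].
have exA : exists n, `[< exists2 V, A V & mod_length V = n >].
  by exists (mod_length V0); apply/asboolP; exists V0.
case: (ex_minnP exA) => n /asboolP[V AV Vn] minn; exists V => // W AW.
by rewrite Vn; apply: minn; apply/asboolP; exists W.
Qed.

Definition span n (e : 'I_n -> M) : set M :=
  range (fun a : 'I_n -> R => \sum_i a i *: e i).

Lemma submodule_span n (e : 'I_n -> M) : submodule (span e).
Proof.
apply/submoduleP; split=> [|a _ _ [b _ <-] [c _ <-]].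
  by exists (fun=> 0) => //; apply: big1 => i _; rewrite scale0r.
exists (fun i => a * b i + c i) => //.
rewrite scaler_sumr -big_split; apply: eq_bigr => i _ /=.
by rewrite scalerDl scalerA.
Qed.

Lemma span_id n (e : 'I_n -> M) i : span e (e i).
Proof.
exists (fun j => (j == i)%:R) => //; rewrite (bigD1 i) //= eqxx scale1r.
by rewrite big1 ?addr0// => j /negbTE ->; rewrite scale0r.
Qed.

Lemma span_sub n (e : 'I_n -> M) U :
  submodule U -> (forall i, U (e i)) -> span e `<=` U.
Proof.
move=> sU Ue _ [a _ <-]; apply: submod_sum => // i _; exact: submodZ.
Qed.

(** Take a maximal one among the finitely spanned submodules of [U]; adjoining a further [x] of [U]
    as a generator cannot enlarge it, so it is [U]. *)
Lemma fl_span U : submodule U -> fl U ->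
  exists n (e : 'I_n -> M), (forall i, U (e i)) /\ span e = U.
Proof.
move=> sU fU.
have [|V|V [n [e [Ue <-]]] maxV] := @exists_max_len [set V | exists n
  (e : 'I_n -> M), (forall i, U (e i)) /\ span e = V] _ sU fU.
- by exists (span (fun i : 'I_0 => 0)), 0%N, (fun=> 0); split=> // -[].
- move=> [n [e [Ue <-]]]; split; [exact: submodule_span | exact: span_sub].
exists n, e; split=> //; apply/seteqP; split=> [|x Ux]; first exact: span_sub.
pose e' (i : 'I_n.+1) := if unlift ord0 i is Some j then e j else x.
have Ue' i : U (e' i) by rewrite /e'; case: unliftP.
rewrite -(maxV (span e')); last first.
- apply: span_sub; first exact: submodule_span.
  move=> i; rewrite -[e i]/(oapp e x (Some i)) -(liftK ord0 i).
  by have := span_id e' (lift ord0 i); rewrite /e' liftK.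
- by exists n.+1, e'.
by have := span_id e' ord0; rewrite /e' unlift_none.
Qed.

End Length.

Section LengthMap.
Variables (R : pzRingType) (M N : lmodType R) (f : {linear M -> N}).
Implicit Types (U : set M).

(** The rank is the length of the trace on [ker f] plus the length of the image. It is strictly
    increasing because a [V] inside [W] with the same trace and the same image equals [W]: subtract
    from [x] in [W] a [y] in [V] with the same image. *)
Lemma ubound_len_ker_image U : submodule U ->
  fl (U `&` ker f) -> fl (f @` U) ->
  ubound (chain_lengths U) (mod_length (U `&` ker f) + mod_length (f @` U))%N.
Proof.
move=> sU fK fI; have sK := submodule_ker f.
apply: (@ubound_chain _ _
    (fun V => mod_length (V `&` ker f) + mod_length (f @` V))%N) => [V W|V].
  move=> sV sW WU [VW nWV].
  have sub1 : V `&` ker f `<=` W `&` ker f by move=> x [/VW].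
  have sub2 : f @` V `<=` f @` W by move=> _ [x /VW Wx <-]; exists x.
  have [s1 s2] := (submoduleI sV sK, submoduleI sW sK).
  have [s3 s4] := (submodule_image f sV, submodule_image f sW).
  have f1 : fl (W `&` ker f) by apply: fl_sub fK => x [/WU].
  have f2 : fl (f @` W) by apply: fl_sub fI => _ [x /WU Ux <-]; exists x.
  have le1 := len_le s1 s2 f1 sub1; have le2 := len_le s3 s4 f2 sub2.
  rewrite ltn_neqAle leq_add // andbT; apply/negP => /eqP E.
  have le1' : (mod_length (W `&` ker f) <= mod_length (V `&` ker f))%N.
    by rewrite -(leq_add2r (mod_length (f @` W))) -E leq_add2l.
  have le2' : (mod_length (f @` W) <= mod_length (f @` V))%N.
    by rewrite -(leq_add2l (mod_length (W `&` ker f))) -E leq_add2r.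
  have E1 := len_eq s1 s2 f1 sub1 le1'; have E2 := len_eq s3 s4 f2 sub2 le2'.
  apply: nWV => x Wx; have : (f @` W) (f x) by exists x.
  rewrite -E2 => -[y Vy fy]; rewrite -(subrK y x); apply: submodD => //.
  suff : (W `&` ker f) (x - y) by rewrite -E1 => -[].
  split; first by apply: submodB => //; exact: VW.
  by rewrite /ker /= linearB fy subrr.
move=> sV VU; apply: leq_add; apply: len_le => //.
- exact: submoduleI.
- exact: submoduleI.
- by move=> x [/VU].
- exact: submodule_image.
- exact: submodule_image.
- by move=> _ [x /VU Ux <-]; exists x.
Qed.

(** The other half of the additivity of length: a chain in the image pulls back to a chain of
    submodules of [U] that contain the kernel part of [U], whose length is therefore subtracted. *)
Lemma ubound_len_image U : submodule U -> fl U ->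
  ubound (chain_lengths (f @` U)) (mod_length U - mod_length (U `&` ker f))%N.
Proof.
move=> sU fU; have sK := submodule_ker f.
have fK : fl (U `&` ker f) by apply: fl_sub fU => x [].
have sUV V : submodule V -> submodule (U `&` f @^-1` V).
  by move=> sV; exact/submoduleI/submodule_preimage.
have leK V : submodule V ->
    (mod_length (U `&` ker f) <= mod_length (U `&` f @^-1` V))%N.
  move=> sV; apply: len_le.
  - exact: submoduleI.
  - exact: sUV.
  - by apply: fl_sub fU => x [].
  - by move=> x [Ux /= fx0]; split=> //=; rewrite fx0; exact: submod0.
apply: (@ubound_chain _ _
    (fun V => mod_length (U `&` f @^-1` V) - mod_length (U `&` ker f))%N)
    => [V W|V].
  move=> sV sW WU [VW nWV].
  suff lt : (mod_length (U `&` f @^-1` V) < mod_length (U `&` f @^-1` W))%N.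
    by apply: ltn_sub2r => //; apply: leq_ltn_trans lt; exact: leK.
  apply: mod_length_lt; [exact: sUV|by apply: fl_sub fU => x []|split].
    exact: sUV.
  split=> [x [Ux /= /VW]//|sub]; apply: nWV => y Wy; have [x Ux xy] := WU _ Wy.
  by have [|_ /=] := sub x; [split=> //=; rewrite xy | rewrite xy].
move=> sV VU; apply: leq_sub2r; apply: len_le => //; exact: sUV.
Qed.

Lemma fl_image U : submodule U -> fl U -> fl (f @` U).
Proof. by move=> sU fU; apply: ubound_fl (ubound_len_image sU fU). Qed.

Lemma len_image U :
  submodule U -> fl U -> (mod_length (f @` U) <= mod_length U)%N.
Proof.
move=> sU fU; apply: leq_trans (leq_subr (mod_length (U `&` ker f)) _).
by apply: ubound_len; [exact: submodule_image | exact: ubound_len_image].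
Qed.

Lemma len_image_ker U : submodule U -> fl U ->
  (mod_length (U `&` ker f) + mod_length (f @` U) <= mod_length U)%N.
Proof.
move=> sU fU; rewrite -leq_subRL.
  by apply: ubound_len; [exact: submodule_image | exact: ubound_len_image].
apply: len_le => //; exact/submoduleI/submodule_ker.
Qed.

Lemma fl_ker_image U :
  submodule U -> fl (U `&` ker f) -> fl (f @` U) -> fl U.
Proof. by move=> sU fK fI; apply: ubound_fl; exact: ubound_len_ker_image. Qed.

Lemma len_ker_image U : submodule U -> fl (U `&` ker f) -> fl (f @` U) ->
  (mod_length U <= mod_length (U `&` ker f) + mod_length (f @` U))%N.
Proof.
by move=> sU fK fI; apply: ubound_len => //; exact: ubound_len_ker_image.
Qed.

Hypothesis injf : injective f.

Lemma inj_ker U : submodule U -> U `&` ker f = [set 0].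
Proof.
move=> sU; apply/seteqP; split=> [x [_ /= fx]|_ ->].
  by apply: injf; rewrite linear0.
by split; [exact: submod0 | rewrite /ker /= linear0].
Qed.

Lemma fl_inj U : submodule U -> fl (f @` U) -> fl U.
Proof. by move=> sU; apply: fl_ker_image; rewrite ?inj_ker //; exact: fl0. Qed.

Lemma len_inj U : submodule U -> fl (f @` U) ->
  mod_length (f @` U) = mod_length U.
Proof.
move=> sU fI; apply/eqP; rewrite eqn_leq len_image //; last exact: fl_inj.
have := @len_ker_image U sU; rewrite inj_ker // len0; apply=> //; exact: fl0.
Qed.

Lemma finite_length_inj : finite_length N -> finite_length M.
Proof. by move=> fN; apply: fl_inj; [exact: submoduleT | exact: flT]. Qed.

End LengthMap.

Definition len (R : pzRingType) (M : lmodType R) := mod_length [set: M].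

Section LengthType.
Variables (R : pzRingType).
Implicit Types M N : lmodType R.

Lemma finite_length_surj M N (f : {linear M -> N}) :
  range f = setT -> finite_length M -> finite_length N.
Proof.
by move=> sf fM; rewrite /finite_length -sf; apply: fl_image;
  [exact: submoduleT |].
Qed.

Lemma len_inj_eq M N (f : {linear M -> N}) :
  injective f -> finite_length N -> (len N <= len M)%N -> range f = setT.
Proof.
move=> injf fN le; apply: len_eq => //; first exact: submodule_range.
  exact: submoduleT.
rewrite len_inj //; [exact: submoduleT | exact: flT].
Qed.

Lemma len_surj_eq M N (f : {linear M -> N}) :
  range f = setT -> finite_length M -> (len M <= len N)%N -> injective f.
Proof.
move=> sf fM le; apply: ker0_inj.
rewrite -(@len_eq _ _ [set 0] (ker f)) //.
- exact: submodule0.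
- exact: submodule_ker.
- exact: flT.
- by move=> _ ->; rewrite /ker /= linear0.
rewrite len0 -(leq_add2r (len N)); apply: leq_trans le.
rewrite /len -sf -[ker f]setTI; apply: len_image_ker => //.
exact: submoduleT.
Qed.

Lemma finite_length_prod M N :
  finite_length M -> finite_length N -> finite_length (M * N)%type.
Proof.
move=> fM fN.
apply: (@fl_ker_image _ _ _ (linear_map (linearP (@fst M N)))).
- exact: submoduleT.
- have l : linear (fun y : N => (0, y) : M * N).
    by move=> a x y; rewrite -[RHS]/(a *: 0 + 0, a *: x + y) scaler0 addr0.
  apply: (@fl_sub _ _ _ (linear_map l @` setT)).
    by move=> [x y] [_ x0]; exists y => //=; congr pair; exact/esym/x0.
  by apply: fl_image => //; exact: submoduleT.
- exact: flT.
Qed.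

Lemma finite_length_ffun M n : finite_length M -> finite_length ('I_n -> M).
Proof.
move=> fM.
pose K m : set ('I_n -> M) := [set g | forall i : 'I_n, (m <= i)%N -> g i = 0].
have sK m : submodule (K m).
  apply/submoduleP; split=> // a u v Ku Kv i mi.
  by rewrite -[LHS]/(a *: u i + v i) Ku ?Kv ?scaler0 ?addr0.
suff: forall m, fl (K m).
  by move=> /(_ n); apply: fl_sub => g _ i; rewrite leqNgt ltn_ord.
elim=> [|m IHm].
  by apply: fl_sub (fl0 _) => g Kg; apply/funext => i; exact: Kg.
case: (ltnP m n) => mn; last first.
  apply: fl_sub IHm => g _ i mi.
  by have := leq_trans mn mi; rewrite leqNgt ltn_ord.
pose i0 := Ordinal mn.
have l : linear (fun g : 'I_n -> M => g i0) by [].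
apply: (@fl_ker_image _ _ _ (linear_map l)) => //; last exact: flT.
apply: fl_sub IHm => g [Kg /= gi0] i; rewrite leq_eqVlt => /predU1P[mi|].
  by rewrite -[RHS]gi0; congr g; exact: val_inj.
exact: Kg.
Qed.

End LengthType.

(** * Commutative artinian rings have finite length *)

Lemma fl_sum (R : pzRingType) (M : lmodType R) (V W : set M) :
  submodule V -> submodule W -> fl V -> fl W -> fl (sum_set V W).
Proof.
move=> sV sW fV fW; apply: (@fl_ker_image _ _ _ (quot_map sV)).
- exact: submodule_sum.
- by apply: fl_sub fV => x [_] /quot_map0.
apply: fl_sub (fl_image (quot_map sV) sW fW).
move=> _ [_ [v Vv [w Ww <-]] <-]; exists w => //.
by rewrite linearD (iffRL (quot_map0 sV v) Vv) add0r.
Qed.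

Section HopkinsAkizuki.
Variable k : comPzRingType.
Hypothesis artk : artinian k.

Lemma artinian_min (A : set (set k^o)) :
  A !=set0 -> (forall V, A V -> submodule V) ->
  exists2 V, A V & forall W, A W -> W `<=` V -> W = V.
Proof.
move=> [V0 AV0] Asub; apply: contrapT => nmin.
have next (V : {V | A V}) : exists W : {V | A V}, sval W `<` sval V.
  case: V => V AV /=; apply: contrapT => nW; apply: nmin; exists V => // W AW WV.
  apply/seteqP; split=> //; apply: contrapT => nVW; apply: nW.
  by exists (exist _ W AW).
pose g V := projT1 (cid (next V)).
have gP V : sval (g V) `<` sval V by rewrite /g; case: cid.
have [||N /(_ N.+1 (leqnSn N))] :=
    artk (I := fun n => sval (iter n g (exist _ V0 AV0))).
- by move=> n; apply: Asub; exact: svalP.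
- by move=> n; have [] := gP (iter n g (exist _ V0 AV0)).
by move=> /= E; have [_] := gP (iter N g (exist _ V0 AV0)); apply; rewrite E.
Qed.

Let mul_linear (x : k) : linear (fun y : k^o => (x * y : k^o)).
Proof. by move=> a y z; rewrite mulrDr !mulrA (mulrC x a) -mulrA. Qed.

(** Take an ideal [I] minimal among those of infinite length. Each scalar kills [I] or acts
    invertibly on it, so [I] is in effect a vector space over a field: a nonzero line is simple, and
    a complement of a line is a proper subideal, hence of finite length. Then [I] itself has finite
    length. *)
Lemma artinian_finite_length : finite_length k^o.
Proof.
apply: contrapT => nfl.
have [||I [sI nflI] minI] := @artinian_min [set I | submodule I /\ ~ fl I].
- by exists setT; split=> //; exact: submoduleT.
- by move=> V [].
have flI W : submodule W -> W `<=` I -> (exists2 y, I y & ~ W y) -> fl W.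
  move=> sW WI [y Iy nWy]; apply: contrapT => nW.
  by apply: nWy; rewrite (minI W).
have kill_or_inv x : (forall y, I y -> x * y = 0) \/
    (exists c, forall y, I y -> c * x * y = y).
  pose f := linear_map (mul_linear x); have sf := submodule_image f sI.
  have fI : f @` I `<=` I by move=> _ [y Iy <-]; exact: submodZ.
  have [flfI|nflfI] := pselect (fl (f @` I)).
    left=> y Iy; have : (I `&` ker f) y by rewrite (minI (I `&` ker f)) //;
      split; [exact/submoduleI/submodule_ker |];
      move=> flK; apply: nflI; exact: fl_ker_image flK flfI.
    by case.
  have EI : f @` I = I by exact: minI.
  (* Stability of the powers gives [x^N = c x^(N+1)]; as [x I = I], each [y] in [I] is [x^N z] with
     [z] in [I], whence [c x y = y]. *)
  right; have [||N /(_ N.+1 (leqnSn N)) EN] :=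
      artk (I := fun n => line (x ^+ n : k^o)).
  - by move=> n; exact: submodule_line.
  - move=> n; apply: line_sub; first exact: submodule_line.
    by exists x => //; rewrite exprS.
  have := line_id (x ^+ N : k^o); rewrite -EN => -[c _ Ec].
  exists c => y Iy; suff: exists2 z, I z & x ^+ N * z = y.
    move=> [z Iz <-]; rewrite -[c * x * _]mulrA [x * _]mulrA -exprS.
    by rewrite mulrA -[c * _]/(c *: (x ^+ N.+1 : k^o)) Ec.
  elim: N {EN Ec} y Iy => [|N IHN] y Iy.
    by exists y => //; rewrite expr0 mul1r.
  move: Iy; rewrite -{1}EI => -[z /IHN[w Iw <-] <-]; exists w => //.
  by rewrite exprS -mulrA.
have I0 : I <> [set 0] by move=> I0; apply: nflI; rewrite I0; exact: fl0.
have [z Iz z0] := set0_neq sI I0.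
have flz : fl (line z).
  apply: (@ubound_fl _ _ _ 1); apply: (@ubound_chain _ _ (fun W => `[< W z >]))
    => [V W sV sW Wz [VW nWV]|V _ _]; last by case: `[< _ >].
  case: (asboolP (V z)) => [/(line_sub sV) zV|_].
    by case: nWV; exact: subset_trans zV.
  case: (asboolP (W z)) => // nz; exfalso; apply: nWV => x Wx.
  have [a _ xE] := Wz _ Wx; rewrite -xE in Wx *.
  case: (kill_or_inv a) => [/(_ z Iz) az|[c /(_ z Iz) caz]].
    by rewrite /GRing.scale /= az; exact: submod0.
  by case: nz; rewrite -caz -mulrA; exact: submodZ Wx.
have [|V [Vsub maxV]] := @Zorn_bigcup k^o
  [set V | (V = set0 \/ submodule V) /\ (V `<=` I /\ ~ V z)].
  move=> F FP Ftot; split; last first.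
    split; first by move=> y [V /FP[_ [VI _]] /VI].
    by move=> [V /FP[_ [_]]].
  have [[V [FV [y Vy]]]|nV] := pselect (exists V, F V /\ V !=set0); last first.
    left; apply/seteqP; split=> // y [V FV Vy]; apply: nV.
    by exists V; split=> //; exists y.
  right; apply/submoduleP; split.
    exists V => //; have [[V0|sV _]] := FP _ FV; last exact: submod0.
    by rewrite V0 in Vy.
  move=> a u v [W FW Wu] [W' FW' W'v].
  have sub X x : F X -> X x -> submodule X.
    by move=> /FP[[->//|]].
  have [WW'|W'W] := Ftot _ _ FW FW'.
    exists W' => //; have sW' := sub _ _ FW' W'v.
    by apply: submodD => //; apply: submodZ => //; exact: WW'.
  exists W => //; have sW := sub _ _ FW Wu.
  by apply: submodD => //; [exact: submodZ | exact: W'W].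
have {maxV} maxV W : V `<=` W -> submodule W -> W `<=` I -> ~ W z -> W = V.
  move=> VW sW WI Wz; apply/seteqP; split=> //; apply: contrapT => nWV.
  by apply: (maxV W); split=> //; right.
case: Vsub => -[V0|sV] [VI nVz].
  suff : V 0 by rewrite V0.
  rewrite -(maxV [set 0]) //.
  - by rewrite V0.
  - exact: submodule0.
  - by move=> _ ->; exact: submod0.
  - by move=> /= z00; rewrite z00 eqxx in z0.
have fV : fl V by apply: flI => //; exists z.
apply: nflI; apply: fl_sub (fl_sum sV (submodule_line z) fV flz).
(* A [w] outside [V + k z] is outside [V], so by maximality [V + k w] contains [z = v + c w]. As [z]
   is not in [V], [c] does not kill [w]; it is thus invertible on [I], and [w] lies in [V + k z]. *)
move=> w Iw; apply: contrapT => nw.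
have sVw := submodule_sum sV (submodule_line w).
have [v Vv [_ [c _ <-] Ez]] : sum_set V (line w) z.
  apply: contrapT => nVwz; apply: nw; apply: sum_setl.
    exact: submodule_line.
  rewrite -(maxV (sum_set V (line w))) //.
  - exact/sum_setr/line_id.
  - exact/sum_setl/submodule_line.
  - by apply: sum_set_sub => //; exact: line_sub.
case: (kill_or_inv c) => [/(_ w Iw) cw|[d /(_ w Iw) dcw]].
  by apply: nVz; rewrite -Ez /GRing.scale /= cw addr0.
apply: nw; exists (d *: - v); first by apply: submodZ => //; exact: submodN.
exists (d *: z); first by exists d.
by rewrite -scalerDr -Ez addKr scalerA.
Qed.

End HopkinsAkizuki.

(** * Duality over a commutative artinian ring *)

Section DualizingModule.
Variable k : comPzRingType.

Definition maximal_ideal (m : set k^o) : Prop :=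
  [/\ submodule m, ~ m 1 &
      forall m', submodule m' -> m `<=` m' -> ~ m' 1 -> m' = m].

Definition annihilated (M : lmodType k) (m : set k^o) : set M :=
  [set x | forall c, m c -> c *: x = 0].

(** The part killed by [m] is zero or a copy of [k/m]: each simple module occurs at most once in the
    socle. *)
Definition small_socle (J : lmodType k) : Prop :=
  forall m (x y : J), maximal_ideal m -> annihilated m x -> annihilated m y ->
    x <> 0 -> line x y.

Lemma maximal_ideal_inv m c : maximal_ideal m -> ~ m c ->
  exists d : k, m (1 - d * c).
Proof.
move=> [sm m1 maxm] nmc.
have slc := submodule_line (c : k^o).
have [a ma [_ [d _ <-] /= E]] : sum_set m (line (c : k^o)) 1.
  apply: contrapT => n1; apply: nmc; rewrite -(maxm _ _ _ n1).
  - exact/sum_setr/line_id.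
  - exact: submodule_sum.
  - exact: sum_setl.
by exists d; rewrite -E addrK.
Qed.

Lemma exists_maximal_ideal (I : set k^o) : finite_length k^o ->
  submodule I -> ~ I 1 -> exists2 m, maximal_ideal m & I `<=` m.
Proof.
move=> fk sI I1.
have [||m [sm Im m1] maxm] := @exists_max_len _ _
  [set m : set k^o | [/\ submodule m, I `<=` m & ~ m 1]] _ (@submoduleT _ k^o) fk.
- by exists I; split=> //; exact: subset_refl.
- by move=> V [].
exists m => //; split=> // m' sm' mm' m'1; apply: maxm => //.
by split=> //; exact: subset_trans mm'.
Qed.

Lemma ubound_uniserial1 (J : lmodType k) (T : set J) : submodule T ->
  (forall x y, T x -> T y -> x <> 0 -> line x y) -> ubound (chain_lengths T) 1%N.
Proof.
move=> sT Tline; apply: (@ubound_chain _ _ (fun W => `[< W <> [set 0] >])).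
  move=> V W sV sW WT [VW nWV].
  case: (asboolP (V <> _)) => [/(set0_neq sV)[x Vx /eqP x0]|/contrapT V0].
    case: nWV => y Wy; apply: (line_sub sV Vx).
    by apply: Tline => //; apply: WT => //; exact: VW.
  case: asboolP => // /contrapT W0; case: nWV.
  by rewrite W0 V0.
by move=> V _ _; case: `[< _ >].
Qed.

Lemma scale_linear (M : lmodType k) (x : M) :
  linear (fun c : k^o => c *: x : M).
Proof. by move=> a b c; rewrite scalerDl -scalerA. Qed.

Lemma scaler_linear (M : lmodType k) (a : k) : linear (fun x : M => a *: x).
Proof. by move=> b x y; rewrite scalerDr !scalerA mulrC. Qed.

Section Functionals.
Variables (N J : lmodType k).

(** Linearity is a condition on plain functions, so that the dual is a submodule of [N -> J] and has
    a length. *)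
Definition functionals (N1 : set N) : set (N -> J) :=
  [set f | linear f /\ forall x, N1 x -> f x = 0].

Lemma submodule_functionals N1 : submodule (functionals N1).
Proof.
apply/submoduleP; split.
  by split=> // a x y; rewrite -[RHS]/(a *: (0 : J) + 0) scaler0 addr0.
move=> a f g [lf f0] [lg g0]; split.
  move=> b x y; pose h z := a *: f z + g z.
  rewrite -[LHS]/(h _) -[RHS]/(b *: h x + h y) /h lf lg.
  by rewrite !scalerDr !scalerA (mulrC b) addrACA.
by move=> x N1x; rewrite -[LHS]/(a *: f x + g x) f0 // g0 // scaler0 addr0.
Qed.

Hypotheses (sJ : small_socle J) (fN : finite_length N).

(* Evaluation at [x] in [N2 \ N1], where [N1] is maximal in [N2], embeds the
   functionals vanishing on [N1] modulo those vanishing on [N2] in the socle. *)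
Lemma len_functionals N1 : submodule N1 ->
  fl (functionals N1) /\
  (mod_length (functionals N1) + mod_length N1 <= len N)%N.
Proof.
have [n] := ubnP (len N - mod_length N1)%N.
elim: n => // n IHn in N1 *; rewrite ltnS => leN sN1.
have [->|N1T] := pselect (N1 = setT).
  suff -> : functionals setT = [set 0] by rewrite len0; split=> //; exact: fl0.
  apply/seteqP; split=> [f [_ f0]|_ ->]; first by apply/funext => x; exact: f0.
  by have /submoduleP[] := submodule_functionals setT.
have [|N2 [sN2 [N12 nN21]] minN2] := @exists_min_len _ _
  [set W | submodule W /\ N1 `<` W].
  exists setT; split; first exact: submoduleT.
  by split=> // TN1; apply: N1T; apply/seteqP.
have [x N2x nN1x] : exists2 x, N2 x & ~ N1 x.
  apply: contrapT => nx; apply: nN21 => x N2x; apply: contrapT => nN1x.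
  by apply: nx; exists x.
have gen y : N2 y -> ~ N1 y -> sum_set N1 (line y) = N2.
  move=> N2y nN1y; have sl := submodule_line y.
  have sS := submodule_sum sN1 sl.
  apply: len_eq => //; first exact: flT.
    by apply: sum_set_sub => //; exact: line_sub.
  apply: minN2; split=> //; split; first exact: sum_setl.
  by move=> /(_ y) H; apply: nN1y; apply: H; exact/sum_setr/line_id.
(* The annihilator of [x] modulo [N1] is maximal because [N2 / N1] is simple. The values at [x] of
   functionals vanishing on [N1] are killed by [m], so by [small_socle] they form a module of length
   at most one. *)
pose m : set k^o := linear_map (scale_linear x) @^-1` N1.
have maxm : maximal_ideal m.
  split; first exact: submodule_preimage.
    by rewrite /m /= scale1r.
  move=> m' sm' mm' m'1; apply/seteqP; split=> // c m'c; apply: contrapT => nmc.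
  have : sum_set N1 (line (c *: x)) x by rewrite gen //; exact: submodZ.
  move=> [v N1v [_ [d _ <-]] E]; apply: m'1.
  rewrite -(subrK (d *: (c : k^o)) 1); apply: submodD => //; last exact: submodZ.
  by apply: mm'; rewrite /m /= scalerBl scale1r -scalerA -{1}E addrK.
pose ev := linear_map (fun (a : k) (f g : N -> J) =>
  erefl : (a *: f + g) x = a *: f x + g x).
have sT := submodule_image ev (submodule_functionals N1).
have fT : ubound (chain_lengths (ev @` functionals N1)) 1%N.
  apply: ubound_uniserial1 => //.
  have annT f : functionals N1 f -> annihilated m (ev f).
    by move=> [lf f0] c mc; rewrite -[LHS](linearZ_LR (linear_map lf)); exact: f0.
  by move=> _ _ [f /annT af <-] [g /annT ag <-]; exact: sJ maxm af ag.
have lt12 : (mod_length N1 < mod_length N2)%N.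
  by apply: mod_length_lt => //; exact: flT.
have le2N : (mod_length N2 <= len N)%N.
  by apply: len_le => //; [exact: submoduleT].
have [|fD2 leD2] := IHn N2 _ sN2.
  apply: leq_trans leN; apply: ltn_sub2l => //.
  exact: leq_trans le2N.
have subD : functionals N1 `&` ker ev `<=` functionals N2.
  move=> f [[lf f0] /= fx]; split=> // y; rewrite -(gen x) //.
  move=> [v N1v [_ [c _ <-] <-]].
  rewrite -[LHS]/(linear_map lf _) linearD linearZ_LR /= f0 // add0r.
  by rewrite [f x]fx scaler0.
have sD := submodule_functionals N1.
have sDK := submoduleI sD (submodule_ker ev).
split; first by apply: (@fl_ker_image _ _ _ ev) => //;
  [exact: fl_sub fD2 | exact: ubound_fl fT].
apply: leq_trans leD2.
apply: (@leq_trans (mod_length (functionals N2) + 1 + mod_length N1)).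
  rewrite leq_add2r.
  apply: leq_trans (len_ker_image (f := ev) sD _ _) _.
  - exact: fl_sub fD2.
  - exact: ubound_fl fT.
  apply: leq_add; last exact: ubound_len.
  by apply: len_le => //; exact: submodule_functionals.
by rewrite -addnA leq_add2l add1n.
Qed.

End Functionals.

Hypothesis fk : finite_length k^o.

Definition scale_map (M : lmodType k) (x : M) : {linear k^o -> M} :=
  linear_map (scale_linear x).

(** [J] embeds in its functionals on [k] by [x |-> (c |-> c *: x)], and [len_functionals] bounds
    these by the length of [k]. *)
Lemma small_socle_len (J : lmodType k) : small_socle J ->
  finite_length J /\ (len J <= len k^o)%N.
Proof.
move=> sJ; have lj : linear (fun (x : J) (c : k^o) => c *: x).
  move=> a x y; apply/funext => c.
  by rewrite -[RHS]/(a *: (c *: x) + c *: y) scalerDr !scalerA mulrC.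
pose j := linear_map lj.
have injj : injective j.
  by move=> x y /(congr1 (fun f : k^o -> J => f 1)); rewrite /= !scale1r.
have [fD leD] := len_functionals sJ fk (submodule0 k^o).
have jD : range j `<=` @functionals k^o J [set 0].
  move=> _ [x _ <-]; split=> [|c -> /=]; last by rewrite scale0r.
  exact: scale_linear.
have fI := fl_sub jD fD; split; first exact: fl_inj (submoduleT J) fI.
rewrite /len -(len_inj injj (submoduleT J) fI).
apply: leq_trans leD; rewrite len0 addn0; apply: len_le => //.
  exact: submodule_range.
exact: submodule_functionals.
Qed.

(** For [k] of finite length this is the injective hull of the direct sum of the [k/m], one copy for
    each maximal ideal, described by maximality instead of injectivity. *)
Definition dualizing (J : lmodType k) : Prop :=
  small_socle J /\ forall (J' : lmodType k) (j : {linear J -> J'}),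
    small_socle J' -> injective j -> range j = setT.

Lemma dualizing_exists : exists J, dualizing J.
Proof.
have exJ : exists n, `[< exists2 J, small_socle J & len J = n >].
  pose J0 := submod_type (submodule0 k^o).
  exists (len J0); apply/asboolP; exists J0 => // m x y _ _ _ x0.
  case: x0; apply: (@submod_val_inj _ _ _ (submodule0 k^o) x 0).
  by rewrite linear0; exact: (submod_valP x).
have ubJ n : `[< exists2 J, small_socle J & len J = n >] -> (n <= len k^o)%N.
  by move=> /asboolP[J sJ <-]; have [] := small_socle_len sJ.
case: (ex_maxnP exJ ubJ) => n /asboolP[J sJ Jn] maxn.
exists J; split=> // J' j sJ' injj; apply: len_inj_eq injj _ _.
  by have [] := small_socle_len sJ'.
by rewrite Jn; apply: maxn; apply/asboolP; exists J'.
Qed.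

Section Duality.
Variable J : lmodType k.
Hypothesis dJ : dualizing J.

(** Without such an [x], the product of [J] with [k/m] would still have a small socle and would
    properly extend [J]. *)
Lemma dualizing_socle m : maximal_ideal m ->
  exists2 x : J, x <> 0 & annihilated m x.
Proof.
move=> maxm; apply: contrapT => nx; have [sm m1 _] := maxm.
have ann0 (x : J) : annihilated m x -> x = 0.
  by move=> mx; apply: contrapT => x0; apply: nx; exists x.
pose Q := quot_type sm; pose q := quot_map sm.
have lj : linear (fun x : J => (x, 0) : J * Q).
  by move=> a x y; rewrite -[RHS]/(a *: x + y, a *: 0 + 0) scaler0 addr0.
pose j := linear_map lj.
suff sJQ : small_socle (J * Q)%type.
  have := dJ.2 _ j sJQ; have inj : injective j by move=> x y [].
  move=> /(_ inj) surj; have : range j (0, q 1) by rewrite surj.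
  by move=> [x _ [_ /esym/quot_map0]].
move=> m' [x a] [y b] maxm' mxa myb xa0.
have annl (z : J) (c : Q) : annihilated m' ((z, c) : J * Q) ->
    annihilated m' z /\ annihilated m' c.
  by move=> mzc; split=> t mt; have [] := mzc t mt.
have [{mxa}mx ma] := annl _ _ mxa; have [{myb}my mb] := annl _ _ myb.
have [Em|nEm] := pselect (m' = m).
  rewrite {}Em in mx ma my mb; rewrite (ann0 _ mx) in xa0 *; rewrite (ann0 _ my).
  have [c Ec] := quot_map_surj a; have [e Ee] := quot_map_surj b.
  have nmc : ~ m c.
    by move=> mc; apply: xa0; congr pair; rewrite -Ec; exact/quot_map0.
  have [d md] := maximal_ideal_inv maxm nmc.
  pose s : k := (e : k) * d.
  exists s => //; rewrite -[LHS]/(s *: 0, s *: a).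
  congr pair; first exact: scaler0.
  apply/eqP; rewrite eq_sym -subr_eq0 -Ec -Ee -linearZ_LR -linearB.
  apply/eqP/quot_map0; have -> : e - s *: c = (e : k) *: ((1 - d * c) : k^o).
    by rewrite /s /GRing.scale /= mulrBr mulr1 mulrA.
  exact: submodZ.
have [c m'c nmc] : exists2 c, m' c & ~ m c.
  apply: contrapT => nc; apply: nEm; apply/esym.
  have [_ _ maxm'3] := maxm'; apply: maxm'3 => // c m'c; apply: contrapT => nmc.
  by apply: nc; exists c.
have [d md] := maximal_ideal_inv maxm nmc.
have ann0Q (t : Q) : annihilated m' t -> t = 0.
  move=> m't; have [e Ee] := quot_map_surj t.
  rewrite -[t]scale1r -(subrK (d * c) 1) scalerDl -scalerA (m't c m'c) scaler0 addr0.
  rewrite -Ee -linearZ_LR; apply/quot_map0.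
  by rewrite /GRing.scale /= mulrC; exact: submodZ.
rewrite (ann0Q _ ma) in xa0 *; rewrite (ann0Q _ mb).
have [|t _ <-] := dJ.1 m' x y maxm' mx my; first by move=> x0; rewrite x0 in xa0.
by exists t => //; congr pair; exact: scaler0.
Qed.

Lemma linear_factor_inj (R : pzRingType) (M N Q : lmodType R)
  (j : {linear M -> Q}) (f : {linear N -> Q}) : injective j ->
  range f `<=` range j -> exists g : {linear N -> M}, forall x, j (g x) = f x.
Proof.
move=> injj fj; have fjx x : exists y, j y = f x.
  by have [|y _ Ey] := fj (f x); [exists x | exists y].
pose g x := projT1 (cid (fjx x)).
have gE x : j (g x) = f x by rewrite /g; case: cid.
have lg : linear g by move=> a x y; apply: injj; rewrite linearP !gE linearP.
by exists (linear_map lg).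
Qed.

(* [J] is injective because it admits no proper essential extension within
   [small_socle], and it cogenerates because its socle meets every [k/m]. *)
Lemma dualizing_separates (N : lmodType k) (U : set N) z :
  finite_length N -> submodule U -> ~ U z ->
  exists2 psi : {linear N -> J}, forall u, U u -> psi u = 0 & psi z <> 0.
Proof.
move=> fN sU nUz; have [fJ _] := small_socle_len dJ.1.
pose I := scale_map z @^-1` U.
have [||m maxm Im] := @exists_maximal_ideal I fk.
- exact: submodule_preimage.
- by rewrite /I /= scale1r.
have [x x0 mx] := dualizing_socle maxm.
(* Dividing [J * N] by [W0] kills [U] and identifies [(x, 0)] with [- (0, z)]; [J] still embeds
   because every [c] with [c z] in [U] lies in [m] and annihilates [x]. *)
pose W0 : set (J * N) := [set w | exists c u, U u /\ w = (c *: x, c *: z + u)].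
have sW0 : submodule W0.
  apply/submoduleP; split.
    by exists 0, 0; split; [exact: submod0 | rewrite !scale0r addr0].
  move=> a _ _ [c [u [Uu ->]]] [c' [u' [Uu' ->]]].
  exists (a * c + c'), (a *: u + u'); split.
    by apply: submodD => //; exact: submodZ.
  congr pair; first by rewrite scalerDl -scalerA.
  by rewrite scalerDl -scalerA addrACA -scalerDr.
(* Enlarging [W0] to a maximal [W] that meets [J] in zero makes [J] essential in the quotient. The
   quotient then has the socle of [J], so [dualizing] forces [j] to be onto. *)
have [||W [sW W0W WJ] maxW] := @exists_max_len _ _
  [set W : set (J * N) | [/\ submodule W, W0 `<=` W & forall y, W (y, 0) -> y = 0]]
  _ (submoduleT _) (finite_length_prod fJ fN).
- exists W0; split=> // y [c [u [Uu [-> /esym/eqP]]]].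
  rewrite addr_eq0 => /eqP cz; apply: mx; apply: Im.
  by rewrite /I /= cz; exact: submodN.
- by move=> V [].
pose q := quot_map sW.
have lj : linear (fun y : J => q (y, 0)).
  move=> a y y'; rewrite -linearP; congr (q _).
  by rewrite -[RHS]/(a *: y + y', a *: 0 + 0) scaler0 addr0.
pose j := linear_map lj.
have injj : injective j by apply: ker0_inj => y /quot_map0/WJ.
have ess m' p : maximal_ideal m' -> annihilated m' p -> p <> 0 -> range j p.
  move=> maxm' mp p0; have [a Ea] := quot_map_surj p.
  have nWa : ~ W a by move=> Wa; apply: p0; rewrite -Ea; exact/quot_map0.
  have sl := submodule_line a.
  have [y [w Ww [_ [c _ <-] Ey]] y0] :
      exists2 y, sum_set W (line a) (y, 0) & y <> 0.
    apply: contrapT => ny; apply: nWa; rewrite -(maxW (sum_set W (line a))).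
    - exact/sum_setr/line_id.
    - split; [exact: submodule_sum| |].
        by apply: subset_trans W0W _; exact: sum_setl.
      by move=> y Wy; apply: contrapT => y0; apply: ny; exists y.
    - exact: sum_setl.
  have Ejy : j y = c *: p.
    rewrite -Ea -[LHS]/(q (y, 0)) -Ey linearD linearZ_LR.
    by rewrite (iffRL (quot_map0 sW w) Ww) add0r.
  have nm'c : ~ m' c.
    move=> /mp cp; apply: y0; apply: injj; rewrite linear0.
    by rewrite Ejy.
  have [d m'd] := maximal_ideal_inv maxm' nm'c; exists (d *: y) => //.
  rewrite linearZ_LR Ejy /=; apply/eqP; rewrite eq_sym -subr_eq0.
  by rewrite -[p in p - _]scale1r scalerA -scalerBl mp.
have annj m' y : annihilated m' (j y) -> annihilated m' y.
  by move=> my c m'c; apply: injj; rewrite linear0 linearZ_LR /=; exact: my.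
have surj : range j = setT.
  apply: dJ.2 => // m' p p' maxm' mp mp' p0.
  have [->|p'0] := pselect (p' = 0); first by exists 0; rewrite ?scale0r.
  have [y _ Ey] := ess _ _ maxm' mp p0; have [y' _ Ey'] := ess _ _ maxm' mp' p'0.
  rewrite -Ey in mp p0 *; rewrite -Ey' in mp' p'0 *.
  have [|c _ <-] := dJ.1 m' y y' maxm' (annj _ _ mp) (annj _ _ mp').
    by move=> y0; apply: p0; rewrite y0 linear0.
  by exists c => //; rewrite linearZ_LR.
(* The sign turns membership of [(y, n)] in [W] into [psi n = y], as [q] then identifies [(y, 0)]
   with [- (0, n)]. *)
have lf : linear (fun n : N => - q (0, n)).
  move=> a n n'; rewrite scalerN -opprD -linearP; congr (- q _).
  by rewrite -[RHS]/(a *: 0 + 0, a *: n + n') scaler0 addr0.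
have [|psi psiE] := @linear_factor_inj _ _ _ _ j (linear_map lf) injj.
  by rewrite surj.
have psiW y n : W (y, n) -> psi n = y.
  move=> Wyn; apply: injj; rewrite psiE -[LHS]/(- q (0, n)).
  apply/esym/eqP; rewrite -addr_eq0 -[j y]/(q (y, 0)) -linearD.
  apply/eqP/quot_map0.
  by rewrite -[X in W X]/(y + 0, 0 + n) addr0 add0r.
exists psi => [u Uu|].
  by apply: psiW; apply: W0W; exists 0, u; rewrite !scale0r add0r.
rewrite (psiW x z) //; apply: W0W; exists 1, 0.
by split; [exact: submod0 | rewrite !scale1r addr0].
Qed.

(** A length count: [k] acts faithfully on [J] because functionals to [J] separate the elements of
    [k], while the module of endomorphisms of [J] has length at most [len J], itself at most the
    length of [k]. *)
Lemma dualizing_end (phi : {linear J -> J}) :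
  exists c : k, forall x, phi x = c *: x.
Proof.
have [fJ leJ] := small_socle_len dJ.1.
have [fD leD] := len_functionals dJ.1 fJ (submodule0 J).
have lr : linear (fun (c : k^o) (x : J) => c *: x).
  move=> a c d; apply/funext => x.
  by rewrite -[RHS]/(a *: (c *: x) + d *: x) scalerDl scalerA.
pose r := linear_map lr.
have injr : injective r.
  apply: ker0_inj => c rc; apply: contrapT => c0.
  have [psi _] := dualizing_separates fk (submodule0 k^o) c0; apply.
  have -> : c = (c : k) *: (1 : k^o) by rewrite /GRing.scale /= mulr1.
  by rewrite linearZ_LR /= -[LHS]/(r c (psi 1)) rc.
have rD : range r `<=` @functionals J J [set 0].
  move=> _ [c _ <-]; split=> [|x -> /=]; last by rewrite scaler0.
  exact: scaler_linear.
have fI := fl_sub rD fD.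
have E : range r = @functionals J J [set 0].
  apply: len_eq => //; [exact: submodule_range|exact: submodule_functionals|].
  rewrite (len_inj injr (submoduleT _) fI).
  by apply: leq_trans leJ; apply: leq_trans leD; exact: leq_addr.
have : functionals [set 0] (phi : J -> J).
  split; first exact: linearP.
  by move=> _ ->; rewrite linear0.
by rewrite -E => -[c _ Ec]; exists c => x; rewrite -Ec.
Qed.

Lemma fl_functionals (N : lmodType k) :
  finite_length N -> fl (@functionals N J [set 0]).
Proof.
by move=> fN; have [] := len_functionals dJ.1 fN (submodule0 N).
Qed.

(** If [v] is not in the image of [X] in [J^n], a functional on [J^n] kills that image but not [v].
    By [dualizing_end] its components are scalars [c i], which contradicts the hypothesis on [v]. *)
Lemma dualizing_bipolar (X : lmodType k) n (xi : 'I_n -> {linear X -> J})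
    (v : 'I_n -> J) :
  (forall c : 'I_n -> k, (forall x, \sum_i c i *: xi i x = 0) ->
    \sum_i c i *: v i = 0) ->
  exists x, forall i, xi i x = v i.
Proof.
move=> vP; have [fJ _] := small_socle_len dJ.1.
have lf : linear (fun (x : X) (i : 'I_n) => xi i x).
  by move=> a x y; apply/funext => i; rewrite linearP.
have [[x _ Ex]|nv] := pselect (range (linear_map lf) v).
  by exists x => i; rewrite -Ex.
have [psi psi0 []] :=
  dualizing_separates (finite_length_ffun n fJ) (submodule_range _) nv.
pose c i := projT1 (cid (dualizing_end (coord_map psi i))).
have cE i y : psi (coord_in i y) = c i *: y.
  by rewrite /c; case: cid => /= d; exact.
have psiE g : psi g = \sum_i c i *: g i.
  by rewrite linear_coord_in; apply: eq_bigr => i _; rewrite cE.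
by rewrite psiE; apply: vP => x; rewrite -psiE; apply: psi0; exists x.
Qed.

End Duality.

End DualizingModule.

(** * Endomorphisms of indecomposable modules and restriction of scalars *)

Section Fitting.
Variables (R : pzRingType) (X : lmodType R).
Hypotheses (fX : finite_length X) (indX : indecomposable [set: X]).

Lemma iter_linear n (f : {linear X -> X}) : linear (iter n f).
Proof. by elim: n => // n IHn a x y; rewrite !iterS IHn linearP. Qed.

(** Fitting's lemma. Once the kernels of the iterates are stable at [n], [X] is the direct sum of
    the kernel and the image of [f^n], and indecomposability makes one of them zero. *)
Lemma injective_or_nilpotent (f : {linear X -> X}) :
  injective f \/ exists n, forall x, iter n f x = 0.
Proof.
pose g n := linear_map (iter_linear n f).
have iter0 n : iter n f 0 = 0 := linear0 (g n).
have kerS m n : ker (g n) `<=` ker (g (m + n)%N).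
  by move=> x gx; rewrite /ker /= iterD [iter n f x]gx iter0.
have [||K [n _ <-] maxn] := @exists_max_len _ _ (range (fun n => ker (g n))) _
  (submoduleT X) fX.
- by exists (ker (g 0%N)), 0%N.
- by move=> _ [n _ <-]; split=> //; exact: submodule_ker.
have {}maxn m : ker (g (m + n)%N) `<=` ker (g n).
  by rewrite -(maxn (ker (g (m + n)%N))) //; exists (m + n)%N.
have cap0 : ker (g n) `&` range (g n) = [set 0].
  apply/seteqP; split=> [x [kx [y _ Ey]]|_ ->]; last first.
    by split; [exact: submod0 (submodule_ker _) | exact: submod0 (submodule_range _)].
  rewrite -Ey; apply: (maxn n); rewrite /ker /= iterD.
  by rewrite -[iter n f y]/(g n y) Ey; exact: kx.
pose sI := submodule_range (g n).
(* Restricted to its own image, [f^n] is injective, since its kernel and image meet in zero, and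
   hence onto by length. So [f^n x = f^n y] for some [y] in the image, and [x] is [(x - y) + y]. *)
have [gI gIE] : exists h : {linear submod_type sI -> submod_type sI},
    forall x, submod_val sI (h x) = g n (submod_val sI x).
  apply: (linear_corestrict sI (f := linear_map (linearP (g n \o submod_val sI)))).
  by move=> x; exists (submod_val sI x).
have fI : finite_length (submod_type sI).
  exact: finite_length_inj (@submod_val_inj _ _ _ sI) fX.
have sgI : range gI = setT.
  apply: len_inj_eq => //; apply: ker0_inj => x gx.
  apply: (@submod_val_inj _ _ _ sI); rewrite linear0.
  have : (ker (g n) `&` range (g n)) (submod_val sI x).
    split; last exact: submod_valP.
    by rewrite /ker /= -[LHS]gIE gx linear0.
  by rewrite cap0.
have sumT : [set: X] = sum_set (ker (g n)) (range (g n)).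
  apply/seteqP; split=> // x _.
  have gx : range (g n) (g n x) by exists x.
  have : range gI (submod_in sI gx) by rewrite sgI.
  move=> [y _ Ey]; exists (x - submod_val sI y).
    have : g n (x - submod_val sI y) = 0 by rewrite linearB -gIE Ey subrr.
    by [].
  by exists (submod_val sI y); [exact: submod_valP | rewrite subrK].
have [|||] := indX.2 _ _ (submodule_ker (g n)) (submodule_range (g n)) _ _ cap0 sumT.
- by [].
- by [].
- move=> k0; left; apply: ker0_inj => x fx; rewrite -k0; apply: (maxn 1%N).
  have E : iter n.+1 f x = 0 by rewrite iterSr [f x]fx iter0.
  exact: E.
- move=> I0; right; exists n => x; have : range (g n) (g n x) by exists x.
  by rewrite I0.

Qed.

(** On [ker v] the map [u] is the identity, so a nilpotent [u] forces [ker v] to vanish. *)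
Lemma noninjective_add (u v : {linear X -> X}) :
  (forall x, u x + v x = x) -> injective u \/ injective v.
Proof.
move=> uv; have [|[n un]] := injective_or_nilpotent u; [by left | right].
apply: ker0_inj => x vx; have ux : u x = x by rewrite -[RHS]uv [v x]vx addr0.
by rewrite -(un x) /=; elim: n {un} => //= n <-.
Qed.

End Fitting.

Lemma inverse_linear (R : pzRingType) (M N : lmodType R) (f : {linear M -> N}) :
  injective f -> range f = setT ->
  exists g : {linear N -> M}, cancel f g /\ cancel g f.
Proof.
move=> injf surjf.
have [|g gE] := @linear_factor_inj R M N N f (linear_map (linearP idfun)) injf.
  by rewrite surjf.
by exists g; split=> // x; apply: injf; rewrite gE.
Qed.

Section LocalEnd.
Variables (R : pzRingType) (X : lmodType R).
Hypotheses (fX : finite_length X) (indX : indecomposable [set: X]).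

Lemma injective_endo_inverse (f : {linear X -> X}) : injective f ->
  exists g : {linear X -> X}, cancel f g /\ cancel g f.
Proof. by move=> injf; apply: inverse_linear => //; exact: len_inj_eq. Qed.

Lemma injective_add (u v : {linear X -> X}) :
  injective (u \+ v) -> injective u \/ injective v.
Proof.
move=> inj; have [w [uvK _]] := injective_endo_inverse inj.
have [x|injwu|injwv] := noninjective_add fX indX
  (u := linear_map (linearP (w \o u))) (v := linear_map (linearP (w \o v))).
- by rewrite /= -linearD; exact: uvK.
- by left; exact: inj_compr injwu.
- by right; exact: inj_compr injwv.
Qed.

Lemma split_mono_inj (Z : lmodType R) (f : {linear X -> Z})
  (h : {linear Z -> X}) : injective (h \o f) -> split_mono f.
Proof.
move=> inj; have [w [hfK _]] := injective_endo_inverse inj.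
by exists (linear_map (linearP (w \o h))) => x; exact: hfK.
Qed.

End LocalEnd.

Section RestrictionOfScalars.
Variables (k : comPzRingType) (L : algType k).

Definition restr (X : lmodType L) : Type := X.

Section Module.
Variable X : lmodType L.

HB.instance Definition _ := GRing.Zmodule.on (restr X).

Definition restr_scale (c : k) (x : restr X) : restr X := (c%:A : L) *: (x : X).

Let scaleA a b x : restr_scale a (restr_scale b x) = restr_scale (a * b) x.
Proof. by rewrite /restr_scale scalerA -scalerAl mul1r scalerA. Qed.
Let scale1 : left_id 1 restr_scale.
Proof. by move=> x; rewrite /restr_scale !scale1r. Qed.
Let scaleDr : right_distributive restr_scale +%R.
Proof. by move=> a x y; exact: scalerDr. Qed.
Let scaleDl x : {morph restr_scale^~ x : a b / a + b}.
Proof. by move=> a b; rewrite /restr_scale !scalerDl. Qed.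

HB.instance Definition _ := GRing.Zmodule_isLmodule.Build k (restr X)
  scaleA scale1 scaleDr scaleDl.

Lemma restr_scaleE (c : k) (x : X) :
  c *: (x : restr X) = (c%:A : L) *: x.
Proof. by []. Qed.

Lemma restr_submodule (U : set X) : submodule U -> submodule (U : set (restr X)).
Proof.
move=> /submoduleP[U0 UD]; apply/submoduleP; split=> // a u v Uu Uv.
exact: UD.
Qed.

Lemma finite_length_restr : finite_length (restr X) -> finite_length X.
Proof.
move=> [n nP]; exists n => l [c [cU clt]]; apply: nP; exists c; split=> // i li.
by have [/restr_submodule] := cU i li.
Qed.

End Module.

Lemma restr_linear (X Z : lmodType L) (f : {linear X -> Z}) :
  linear (f : restr X -> restr Z).
Proof. by move=> a x y; exact: linearP. Qed.

Lemma scalar_central (c : k) (l : L) : c%:A * l = l * c%:A.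
Proof. by rewrite -scalerAl -scalerAr mul1r mulr1. Qed.

Lemma algebra_finite_length : finite_length k^o -> finitely_generated L ->
  finite_length (L : lmodType k).
Proof.
move=> fk [n [e eP]].
have lf : linear (fun a : 'I_n -> k^o => \sum_i (a i : k) *: e i).
  move=> a x y; rewrite scaler_sumr -big_split; apply: eq_bigr => i _ /=.
  by rewrite scalerA -scalerDl.
apply: (@finite_length_surj _ _ _ (linear_map lf)).
  by apply/seteqP; split=> // x _; have [a ->] := eP x; exists a.
exact: finite_length_ffun.
Qed.

Hypothesis fL : finite_length (L : lmodType k).

Lemma regular_finite_length : finite_length (L^o : lmodType L).
Proof.
apply: finite_length_restr.
have l : linear (fun x : restr L^o => (x : L)).
  by move=> a x y; rewrite restr_scaleE /GRing.scale /= -scalerAl mul1r.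
by apply: (@finite_length_inj k _ L (linear_map l)) fL => x y.
Qed.

Lemma finite_length_restr_scalars (X : lmodType L) :
  finite_length X -> finite_length (restr X).
Proof.
move=> fX; have [n [e [_ eP]]] := fl_span (submoduleT X) fX.
have lf : linear (fun a : 'I_n -> L => \sum_i a i *: e i : restr X).
  move=> a x y; rewrite scaler_sumr -big_split; apply: eq_bigr => i _ /=.
  by rewrite restr_scaleE scalerDl scalerA -scalerAl mul1r.
apply: (@finite_length_surj _ _ _ (linear_map lf)).
  by apply/seteqP; split=> // x _; have : span e x by rewrite eP.
exact: finite_length_ffun.
Qed.

End RestrictionOfScalars.

(** * Left almost split maps *)

Definition left_almost_split (R : pzRingType) (X E : lmodType R)
    (e : {linear X -> E}) : Prop :=
  ~ split_mono e /\ forall (Z : lmodType R) (f : {linear X -> Z}),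
    finite_length Z -> ~ split_mono f ->
    exists h : {linear E -> Z}, forall x, h (e x) = f x.

Section LeftAlmostSplit.
Variables (k : comPzRingType) (L : algType k).
Hypotheses (fk : finite_length k^o) (fL : finite_length (L : lmodType k)).
Variables (J : lmodType k).
Hypothesis dJ : dualizing J.
Variable X : lmodType L.
Hypotheses (fX : finite_length X) (indX : indecomposable [set: X]).

Local Notation Xk := (restr X).

Let fXk : finite_length Xk := finite_length_restr_scalars fL fX.

Lemma scaled_endo_linear (a : k) (f g : {linear X -> X}) :
  linear (fun x => a%:A *: f x + g x : X).
Proof.
move=> l x y; rewrite !linearP !scalerDr !scalerA -scalar_central.
by rewrite addrACA.
Qed.

(** Makes the noninjective endomorphisms, which form the radical of the local ring [End X], closed
    under [k]-combinations. *)
Lemma injective_scaled (a : k) (f g : {linear X -> X}) :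
  injective (fun x => a%:A *: f x + g x : X) -> injective f \/ injective g.
Proof.
have l0 : linear (fun x : X => 0 : X) by move=> l x y; rewrite scaler0 addr0.
move=> inj; pose u := linear_map (scaled_endo_linear a f (linear_map l0)).
have [|injau|] := injective_add fX indX (u := u) (v := g).
- by move=> x y /= E; apply: inj; move: E; rewrite !addr0.
- left=> x y E; apply: injau; rewrite /= !addr0; congr (_ *: _); exact: E.
- by right.
Qed.

Lemma zero_noninjective : ~ injective (fun x : X => 0 : X).
Proof.
move=> inj; apply: indX.1; apply/seteqP; split=> // x _; exact: inj.
Qed.

(* A functional on [End X] vanishing on the radical but not at [1], written as
   [s |-> \sum_i xi i (s (q i))], with the [xi i] generating the dual of [X]. *)
Lemma socle_functional :
  exists m (xi : 'I_m -> {linear Xk -> J}) (q : 'I_m -> X),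
  [/\ forall f : {linear Xk -> J},
        exists c : 'I_m -> k, forall x, f x = \sum_i c i *: xi i x,
      forall s : {linear X -> X}, ~ injective s -> \sum_i xi i (s (q i)) = 0 &
      \sum_i xi i (q i) <> 0].
Proof.
have [m [xi0 [xi0D spanxi]]] :=
  fl_span (submodule_functionals J [set 0 : Xk]) (fl_functionals dJ fXk).
have [xi xiE] : exists xi : 'I_m -> {linear Xk -> J},
    forall i x, xi i x = xi0 i x.
  by exists (fun i => linear_map (xi0D i).1).
have xiP (f : {linear Xk -> J}) :
    exists c : 'I_m -> k, forall x, f x = \sum_i c i *: xi i x.
  have : functionals [set 0] (f : Xk -> J).
    by split; [exact: linearP | move=> _ ->; rewrite linear0].
  rewrite -spanxi => -[c _ Ec]; exists c => x.
  by rewrite -Ec fct_sumE; apply: eq_bigr => i _; rewrite xiE.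
have [n [e [_ spane]]] := fl_span (submoduleT Xk) fXk.
(* An endomorphism is determined by its values on the [k]-generators [e], so the radical of [End X]
   becomes a submodule [U] of [X^n]; the identity becomes [e] itself, outside [U]. *)
pose U : set ('I_n -> Xk) := [set g | exists s : {linear X -> X},
  ~ injective s /\ g = fun j => s (e j)].
have sU : submodule U.
  apply/submoduleP; split.
    have l0 : linear (fun x : X => 0 : X) by move=> l x y; rewrite scaler0 addr0.
    by exists (linear_map l0); split; [exact: zero_noninjective|].
  move=> a _ _ [s [ns ->]] [t [nt ->]].
  exists (linear_map (scaled_endo_linear a s t)); split=> //.
  by move=> /injective_scaled[].
have nUe : ~ U (e : 'I_n -> Xk).
  move=> [s [ns Es]]; apply: ns; suff sE x : s x = x by move=> x y; rewrite !sE.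
  have : span e x by rewrite spane.
  move=> [a _ <-]; rewrite -[LHS]/(linear_map (restr_linear s) _) linear_sum.
  by apply: eq_bigr => i _; rewrite linearZ_LR /= {2}Es.
have [psi psi0 psie] :=
  dualizing_separates fk dJ (finite_length_ffun n fXk) sU nUe.
pose c j := projT1 (cid (xiP (coord_map psi j))).
have cE j x : psi (coord_in j x) = \sum_i c j i *: xi i x.
  by rewrite /c; case: cid => /= c' ->.
pose q i : Xk := \sum_j c j i *: e j.
have psiE (s : {linear X -> X}) : \sum_i xi i (s (q i)) = psi (fun j => s (e j)).
  rewrite linear_coord_in; under [RHS]eq_bigr do rewrite cE.
  rewrite exchange_big; apply: eq_bigr => i _ /=.
  have -> : s (q i) = \sum_j c j i *: (s (e j) : Xk).
    rewrite -[LHS]/(linear_map (restr_linear s) _) linear_sum.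
    by apply: eq_bigr => j _; rewrite linearZ_LR.
  by rewrite linear_sum; apply: eq_bigr => j _; rewrite linearZ_LR.
exists m, xi, q; split=> // [s ns|].
  by rewrite psiE; apply: psi0; exists s.
by have := psiE (linear_map (linearP (@idfun X))); rewrite /= => ->.
Qed.

Theorem left_almost_split_exists : exists (E : lmodType L) (e : {linear X -> E}),
  finite_length E /\ left_almost_split e.
Proof.
have [m [xi [q [xiP xi_rad xi1]]]] := socle_functional.
(* The dual of [X] is a right [L]-module by [(xi l)(x) = xi (l x)], and [rel] collects the relations
   of the [xi j] there. It lies in [L^m], of finite length over [k], so finitely many [r i] span it
   over [k]. *)
pose rel : set ('I_m -> L) :=
  [set r | forall x : X, \sum_j xi j ((r j : L) *: x) = 0].
have srel : submodule rel.
  apply/submoduleP; split.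
    by move=> x; apply: big1 => j _; rewrite scale0r linear0.
  move=> a r r' rr rr' x.
  transitivity (a *: \sum_j xi j (r j *: x) + \sum_j xi j (r' j *: x)).
    rewrite scaler_sumr -big_split; apply: eq_bigr => j _ /=.
    rewrite -linearP; congr (xi j _).
    rewrite -[LHS]/((a *: r j + r' j) *: x) scalerDl restr_scaleE scalerA.
    by rewrite -scalerAl mul1r.
  by rewrite rr rr' scaler0 addr0.
have [b [r [relr spanr]]] := fl_span srel (flT _ (finite_length_ffun m fL)).
(* [E] will be the cokernel of [w]: in it [q j] becomes [\sum_i r i j *: y_i], with [y_i] the class
   of the [i]-th basis vector of [L^b]. *)
pose P := (X * ('I_b -> L^o))%type.
have lw : linear (fun l : 'I_m -> L^o =>
    (\sum_j (l j : L) *: q j, fun i => - \sum_j (l j : L) * r i j) : P).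
  move=> a l l'.
  rewrite -[RHS]/(a *: (\sum_j (l j : L) *: q j) + \sum_j (l' j : L) *: q j,
    fun i => (a : L) * (- \sum_j (l j : L) * r i j) + - \sum_j (l' j : L) * r i j).
  congr pair.
    rewrite scaler_sumr -big_split; apply: eq_bigr => j _ /=.
    by rewrite scalerA -scalerDl.
  apply/funext => i; rewrite mulrN -opprD; congr (- _).
  rewrite mulr_sumr -big_split; apply: eq_bigr => j _ /=.
  by rewrite mulrA -mulrDl.
pose w := linear_map lw; have sW := submodule_range w.
pose E := quot_type sW; pose qE := quot_map sW.
have le : linear (fun x : X => qE (x, 0)).
  move=> a x y; rewrite -linearP; congr (qE _).
  by rewrite -[RHS]/(a *: x + y, a *: 0 + 0) scaler0 addr0.
have [e eE] : exists e : {linear X -> E}, forall x, e x = qE (x, 0).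
  by exists (linear_map le).
exists E, e; split.
  apply: (@finite_length_surj _ _ _ qE).
    by apply/seteqP; split=> // y _; have [x <-] := quot_map_surj y; exists x.
  apply: finite_length_prod => //; apply: finite_length_ffun.
  exact: regular_finite_length.
split.
  (* A retraction carries the [y_i] back to [X], so [q j = \sum_i r i j *: y i] holds there; since
     every [r i] is a relation, [\sum_j xi j (q j)] would be zero. *)
  move=> [rho rhoK]; apply: xi1.
  have li : linear (fun y : 'I_b -> L^o => qE (0, y)).
    move=> a x y; rewrite -linearP; congr (qE _).
    by rewrite -[RHS]/(a *: 0 + 0, a *: x + y) scaler0 addr0.
  have [inc incE] : exists g : {linear ('I_b -> L^o) -> E},
      forall y, g y = qE (0, y).
    by exists (linear_map li).
  pose y i := rho (inc (coord_in i 1)).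
  have qy j : q j = \sum_i r i j *: y i.
    have wj : qE (q j, fun i => - r i j) = 0.
      apply/quot_map0; exists (coord_in j 1) => //=; congr pair.
        rewrite (bigD1 j) //= /coord_in eqxx scale1r big1 ?addr0// => j'.
        by move=> /negbTE ->; rewrite scale0r.
      apply/funext => i; rewrite (bigD1 j) //= /coord_in eqxx mul1r.
      by rewrite big1 ?addr0// => j' /negbTE ->; rewrite mul0r.
    have -> : q j = rho (inc (fun i => r i j)).
      rewrite -[LHS]rhoK; congr (rho _); apply/eqP; rewrite -subr_eq0.
      rewrite eE incE -linearB -wj; apply/eqP; congr (qE _).
      by rewrite -[LHS]/(q j - 0, 0 - fun i => r i j) subr0 sub0r.
    rewrite linear_coord_in linear_sum; apply: eq_bigr => i _.
    rewrite /y -linearZ_LR; congr (rho _).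
    have -> : coord_in i (r i j : L^o) = r i j *: coord_in i (1 : L^o).
      rewrite -[RHS](linearZ_LR (linear_map (coord_in_linear i))).
      by rewrite /GRing.scale /= mulr1.
    by rewrite linearZ_LR.
  under eq_bigr do rewrite qy linear_sum.
  by rewrite exchange_big big1 // => i _; exact: relr.
move=> Z f fZ nsplit.
have fZk := finite_length_restr_scalars fL fZ.
have [[z zP]|nz] := pselect (exists z : 'I_b -> Z,
    forall j, f (q j) = \sum_i r i j *: z i).
  have lF : linear (fun p : P => f p.1 + \sum_i (p.2 i : L) *: z i).
    move=> a p p'; rewrite linearP scalerDr -!addrA; congr (_ + _).
    rewrite addrCA; congr (_ + _).
    rewrite scaler_sumr -big_split; apply: eq_bigr => i _ /=.
    by rewrite scalerA -scalerDl.
  have [|g gE] := @quot_factor _ _ _ _ sW (linear_map lF).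
    move=> _ [l _ <-]; rewrite /ker.
    rewrite -[_ _]/(f (\sum_j (l j : L) *: q j) +
      \sum_i (- \sum_j (l j : L) * r i j) *: z i = 0) linear_sum.
    under [X in X + _]eq_bigr => j _ do rewrite linearZ_LR /= zP scaler_sumr.
    rewrite exchange_big -big_split big1 // => i _ /=.
    rewrite scaleNr scaler_suml; apply/eqP; rewrite subr_eq0; apply/eqP.
    by apply: eq_bigr => j _; rewrite scalerA.
  exists g => x; rewrite eE gE /= big1 ?addr0// => i _.
  by rewrite scale0r.
exfalso; apply: nsplit.
pose U : set ('I_m -> restr Z) :=
  [set g | exists z : 'I_b -> Z, g = fun j => \sum_i r i j *: z i].
have sU : submodule U.
  apply/submoduleP; split.
    exists (fun=> 0); apply/funext => j; rewrite big1 // => i _.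
    by rewrite scaler0.
  move=> a _ _ [z ->] [z' ->]; exists (fun i => a%:A *: z i + z' i).
  apply/funext => j.
  rewrite -[LHS]/(a%:A *: (\sum_i r i j *: z i) + \sum_i r i j *: z' i).
  rewrite scaler_sumr -big_split; apply: eq_bigr => i _ /=.
  by rewrite scalerDr !scalerA scalar_central.
have nUf : ~ U (fun j => f (q j)).
  by move=> [z Ez]; apply: nz; exists z => j; exact: (congr1 (@^~ j) Ez).
have [zeta zeta0 zetaf] :=
  dualizing_separates fk dJ (finite_length_ffun m fZk) sU nUf.
have zeta_rel (s : 'I_m -> L) (z : Z) : rel s ->
    \sum_j coord_map zeta j (s j *: z) = 0.
  rewrite -spanr => -[a _ <-].
  rewrite -(linear_coord_in zeta (fun j => (\sum_i a i *: r i) j *: z)).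
  apply: zeta0; exists (fun i => (a i)%:A *: z); apply/funext => j.
  rewrite fct_sumE scaler_suml; apply: eq_bigr => i _.
  rewrite scalerA -scalar_central -scalerAl mul1r.
  by [].
(* A [k]-linear relation among the [xi j] gives a tuple of scalars in [rel], which the components of
   [zeta] satisfy by [zeta_rel]; this is the hypothesis of [dualizing_bipolar]. *)
have hP (z : Z) : exists x : X, forall j, xi j x = coord_map zeta j z.
  apply: (dualizing_bipolar fk dJ (X := Xk) 
    (v := fun j => coord_map zeta j z)) => c cxi.
  have crel : rel (fun j => (c j)%:A).
    by move=> x; rewrite -[RHS](cxi x); apply: eq_bigr => j _; rewrite -linearZ_LR.
  rewrite -[RHS](zeta_rel _ z crel).
  by apply: eq_bigr => j _; rewrite -linearZ_LR.
pose h z := projT1 (cid (hP z)).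
have hE z j : xi j (h z) = coord_map zeta j z by rewrite /h; case: cid.
have xi_inj (x y : X) : (forall j, xi j x = xi j y) -> x = y.
  move=> xy; apply: contrapT => nxy.
  have nz0 : ~ [set 0 : Xk] (x - y) by move=> /eqP; rewrite subr_eq0 => /eqP.
  have [psi _ []] := dualizing_separates fk dJ fXk (submodule0 Xk) nz0.
  have [c psiE] := xiP psi; rewrite linearB !psiE; apply/eqP; rewrite subr_eq0.
  by apply/eqP; apply: eq_bigr => j _; rewrite xy.
have lh : linear h.
  move=> l z z'; apply: xi_inj => j; rewrite hE (linearD (xi j)) hE.
  rewrite (linearD (coord_map zeta j)); congr (_ + _).
  (* Compatibility with [l]: the functional [x |-> xi j (l *: x)] is a [k]-combination of the
     [xi i]. This identity is an element of [rel], so it carries over to the components of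
     [zeta]. *)
  have lxi : linear (fun x : Xk => xi j (l *: (x : X))).
    move=> a x y; rewrite -linearP; congr (xi j _).
    by rewrite scalerDr !restr_scaleE !scalerA scalar_central.
  have [c cE] := xiP (linear_map lxi).
  have srel' : rel (fun i => (if i == j then l else 0) - (c i)%:A).
    move=> x; under eq_bigr do rewrite scalerBl linearB.
    rewrite sumrB; apply/eqP; rewrite subr_eq0; apply/eqP.
    rewrite (bigD1 j) //= eqxx big1 => [|i /negbTE ->]; last first.
      by rewrite scale0r linear0.
    rewrite addr0 -[LHS]/(linear_map lxi x) cE.
    by apply: eq_bigr => i _; rewrite -linearZ_LR.
  have := zeta_rel _ z srel'; under eq_bigr do rewrite scalerBl linearB.
  rewrite sumrB => /eqP; rewrite subr_eq0 (bigD1 j) //= eqxx.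
  rewrite big1 => [|i /negbTE ->]; last first.
    by rewrite scale0r; exact: (linear0 (coord_map zeta i)).
  rewrite addr0 => /eqP E1; rewrite -[RHS]/(linear_map lxi (h z)) cE.
  rewrite [LHS]E1; apply: eq_bigr => i _; rewrite hE.
  by rewrite -linearZ_LR.
apply: (split_mono_inj fX (h := linear_map lh)).
apply: contrapT => ninj; apply: zetaf.
have hf0 := xi_rad (linear_map (linearP (linear_map lh \o f))) ninj.
rewrite linear_coord_in -[RHS]hf0.
by apply: eq_bigr => j _; rewrite /= hE.
Qed.

End LeftAlmostSplit.

(** * The Gabriel-Roiter measure and Gabriel's main property *)

Section Invariance.
Variables (R : pzRingType) (M N : lmodType R) (f : {linear M -> N}).
Hypothesis injf : injective f.
Implicit Types (U V : set M).

Lemma preimage_image V : f @^-1` (f @` V) = V.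
Proof.
by apply/seteqP; split=> [x [y Vy /injf <-]|x Vx] //; exists x.
Qed.

Lemma image_preimage_sub U (V' : set N) :
  V' `<=` f @` U -> f @` (U `&` f @^-1` V') = V'.
Proof.
move=> V'U; apply/seteqP; split=> [_ [x [_ ?] <-]//|y V'y].
by have [x Ux xy] := V'U _ V'y; exists x => //; split=> //=; rewrite xy.
Qed.

Lemma image_inj_sub U V : f @` U `<=` f @` V -> U `<=` V.
Proof. by move=> UV x Ux; rewrite -[V]preimage_image; apply: UV; exists x. Qed.

Lemma image_inj_eq U V : f @` U = f @` V -> U = V.
Proof. by move=> UV; rewrite -[U]preimage_image UV preimage_image. Qed.

Lemma image_linear0 : f @` [set 0] = [set 0].
Proof. by rewrite image_set1 linear0. Qed.

Lemma image_sum_set U V : f @` (sum_set U V) = sum_set (f @` U) (f @` V).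
Proof.
apply/seteqP; split=> [_ [_ [u Uu [v Vv <-]] <-]|_ [_ [u Uu <-] [_ [v Vv <-] <-]]].
  by exists (f u); [exists u | exists (f v); [exists v | rewrite linearD]].
by exists (u + v); [exists u => //; exists v | rewrite linearD].
Qed.

Lemma proper_submodule_image U (V' : set N) : submodule U ->
  proper_submodule V' (f @` U) <->
  exists2 V, proper_submodule V U & f @` V = V'.
Proof.
move=> sU; split=> [[sV' [V'U nUV']]|[V [sV [VU nUV]] <-]].
  have E := image_preimage_sub V'U; exists (U `&` f @^-1` V') => //.
  split; first exact/submoduleI/submodule_preimage.
  split=> [x []//|UV]; apply: nUV' => _ [x /UV[_ ?] <-] //.
split; first exact: submodule_image.
split=> [_ [x /VU Ux <-]|/image_inj_sub//]; by exists x.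
Qed.

Lemma indecomposable_image U : submodule U ->
  indecomposable (f @` U) <-> indecomposable U.
Proof.
move=> sU; split=> -[U0 ind]; split.
- by move=> EU; apply: U0; rewrite EU image_linear0.
- move=> V W sV sW VU WU VW EU.
  have [||||||V0|W0] := ind (f @` V) (f @` W).
  + exact: submodule_image.
  + exact: submodule_image.
  + by move=> _ [x /VU Ux <-]; exists x.
  + by move=> _ [x /WU Ux <-]; exists x.
  + apply/seteqP; split=> [_ [[x Vx <-] [y Wy /injf xy]]|_ ->].
      have : (V `&` W) x by split=> //; rewrite -xy.
      by rewrite VW => ->; rewrite linear0.
    by split; (exists 0; [exact: submod0 | exact: linear0]).
  + by rewrite EU; exact: image_sum_set.
  + by left; apply: image_inj_eq; rewrite V0 image_linear0.
  + by right; apply: image_inj_eq; rewrite W0 image_linear0.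
- by rewrite -image_linear0 => /image_inj_eq.
- move=> V' W' sV' sW' V'U W'U VW' EU'.
  have EV := image_preimage_sub V'U; have EW := image_preimage_sub W'U.
  have [||||||V0|W0] := ind (U `&` f @^-1` V') (U `&` f @^-1` W').
  + exact/submoduleI/submodule_preimage.
  + exact/submoduleI/submodule_preimage.
  + by move=> x [].
  + by move=> x [].
  + apply/seteqP; split=> [x [[_ V'x] [_ W'x]]|_ ->].
      have : (V' `&` W') (f x) by [].
      by rewrite VW' => fx; apply: injf; rewrite linear0.
    by split; split; rewrite /= ?linear0; exact: submod0.
  + by apply: image_inj_eq; rewrite EU' -[X in _ = f @` X]/(sum_set _ _)
      image_sum_set EV EW.
  + by left; rewrite -EV V0 image_linear0.
  + by right; rewrite -EW W0 image_linear0.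
Qed.

Lemma gr_rec_image n U : submodule U -> fl (f @` U) ->
  gr_rec n (f @` U) = gr_rec n U.
Proof.
elim: n U => //= n IHn U sU fU.
have -> : `[< f @` U = [set 0] >] = `[< U = [set 0] >].
  apply: asbool_equiv_eq; split=> [|->]; last exact: image_linear0.
  by rewrite -image_linear0 => /image_inj_eq.
case: asboolP => // U0; rewrite (len_inj injf sU fU).
rewrite (asbool_equiv_eq (indecomposable_image sU)); congr (_ + max_set _ _).
apply/seteqP; split=> [_ [_ /(proper_submodule_image _ sU)[V VU <-] <-]|].
  exists V => //; rewrite IHn //; first by case: VU.
  by apply: fl_sub fU => _ [x Vx <-]; exists x => //; exact: VU.2.1.
move=> _ [V VU <-]; exists (f @` V).
  by apply/proper_submodule_image => //; exists V.
rewrite IHn //; first by case: VU.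
by apply: fl_sub fU => _ [x Vx <-]; exists x => //; exact: VU.2.1.
Qed.

Lemma gr_measure_image U : submodule U -> fl (f @` U) ->
  gr_measure (f @` U) = gr_measure U.
Proof. by move=> sU fU; rewrite /gr_measure len_inj // gr_rec_image. Qed.

End Invariance.

Section GRMeasure.
Variables (R : pzRingType) (M : lmodType R).
Implicit Types (U V W : set M).

Lemma gr_measure_proper_le V U : submodule U -> fl U -> proper_submodule V U ->
  gr_measure V + (if `[< indecomposable U >] then 2 ^- mod_length U else 0)
    <= gr_measure U.
Proof.
move=> sU fU VU; have U0 : U <> [set 0].
  move=> EU; case: VU => sV [_]; apply; rewrite EU => _ ->; exact: submod0.
rewrite [gr_measure U]gr_measureE // addrC lerD2l.
by have [_] := gr_measure_max sU fU U0; apply; exists V.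
Qed.

Lemma pow2_gt0 n : 0 < 2 ^- n :> rat.
Proof. by rewrite invr_gt0 exprn_gt0. Qed.

Lemma gr_measure_le V U : submodule V -> submodule U -> fl U -> V `<=` U ->
  gr_measure V <= gr_measure U.
Proof.
move=> sV sU fU VU; have [UV|nUV] := pselect (U `<=` V).
  by have -> : V = U by apply/seteqP.
apply: le_trans (gr_measure_proper_le sU fU (conj sV (conj VU nUV))).
by rewrite lerDl; case: ifP => // _; exact/ltW/pow2_gt0.
Qed.

Lemma gr_measure_indecomposable U : submodule U -> fl U -> indecomposable U ->
  exists V, [/\ proper_submodule V U,
    gr_measure U = gr_measure V + 2 ^- mod_length U &
    forall W, proper_submodule W U -> gr_measure W <= gr_measure V].
Proof.
move=> sU fU iU; have [[V VU EV] ub] := gr_measure_max sU fU iU.1.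
exists V; split=> // [|W WU]; last by rewrite EV; apply: ub; exists W.
by rewrite (gr_measureE sU fU iU.1) asboolT // -EV addrC.
Qed.

Lemma decomposableP U : submodule U -> U <> [set 0] -> ~ indecomposable U ->
  exists V W, [/\ proper_submodule V U, proper_submodule W U, V `&` W = [set 0],
    U = sum_set V W & V <> [set 0] /\ W <> [set 0]].
Proof.
move=> sU U0 nind; apply: contrapT => nVW; apply: nind; split=> // V W sV sW VU WU.
move=> VW EU; apply: contrapT => /not_orP[V0 W0]; apply: nVW; exists V, W.
have strict A B : submodule A -> submodule B -> A `<=` U -> B `<=` U ->
    A `&` B = [set 0] -> B <> [set 0] -> proper_submodule A U.
  move=> sA sB AU BU AB B0; split=> //; split=> // UA; apply: B0.
  by rewrite -AB; apply/seteqP; split=> [x Bx|x []//]; split=> //; exact/UA/BU.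
by split=> //; [exact: (strict V W) | apply: (strict W V) => //; rewrite setIC].
Qed.

Lemma gr_measure_ge U : submodule U -> fl U -> U <> [set 0] ->
  2 ^- mod_length U <= gr_measure U.
Proof.
have [n] := ubnP (mod_length U); elim: n => // n IHn in U *.
rewrite ltnS => len sU fU U0; have [iU|nU] := pselect (indecomposable U).
  have [V [VU -> _]] := gr_measure_indecomposable sU fU iU.
  rewrite lerDr -(gr_measure0 M); have [sV _] := VU.
  apply: gr_measure_le => //; first exact: submodule0.
    by apply: fl_sub fU; case: VU => _ [].
  by move=> _ ->; exact: submod0.
have [V [_ [VU _ _ _ [V0 _]]]] := decomposableP sU U0 nU.
have ltVU := mod_length_lt sU fU VU; have [sV [subVU _]] := VU.
apply: le_trans (gr_measure_le sV sU fU subVU).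
apply: le_trans (IHn V _ sV (fl_sub subVU fU) V0); last exact: leq_trans ltVU _.
by rewrite lef_pV2 ?posrE ?exprn_gt0// ler_weXn2l ?ler1n// ltnW.
Qed.

(** Take a shortest one among the proper submodules of greatest measure. If it were nonzero and
    decomposable, its measure would already be attained on a proper submodule of it, which is
    shorter. *)
Lemma gr_predecessor U : submodule U -> fl U -> indecomposable U ->
  exists V, [/\ proper_submodule V U,
    gr_measure U = gr_measure V + 2 ^- mod_length U &
    V = [set 0] \/ indecomposable V].
Proof.
move=> sU fU iU; have [V0 [V0U EV0 maxV0]] := gr_measure_indecomposable sU fU iU.
have [|V [VU EV] minV] := @exists_min_len _ _
  [set V | proper_submodule V U /\ gr_measure V = gr_measure V0].
  by exists V0.
exists V; split=> //; first by rewrite EV.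
apply: contrapT => /not_orP[Vn0 nind].
have [sV [subVU nUV]] := VU; have fV := fl_sub subVU fU.
have [[W WV EW] _] := gr_measure_max sV fV Vn0.
have EVW : gr_measure W = gr_measure V.
  by rewrite (gr_measureE sV fV Vn0) asboolF // add0r.
have ltWV := mod_length_lt sV fV WV; have [sW [subWV nVW]] := WV.
have : (mod_length V <= mod_length W)%N.
  apply: minV; split; last by rewrite EVW.
  split=> //; split; first exact: subset_trans subVU.
  by move=> UW; apply: nUV; exact: subset_trans subWV.
by rewrite leqNgt ltWV.
Qed.

(* Both measures are multiples of [2^-(n-1)]. *)
Lemma gr_measure_gap (N : lmodType R) V (W : set N) n :
  submodule V -> submodule W -> fl V -> fl W ->
  (mod_length V < n)%N -> (mod_length W < n)%N ->
  gr_measure V < gr_measure W -> gr_measure V + 2 ^- n < gr_measure W.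
Proof.
case: n => // n sV sW fV fW; rewrite !ltnS => ltV ltW.
rewrite /gr_measure.
have [a _ ->] := gr_rec_dyadic (mod_length V) sV fV ltV.
have [b _ ->] := gr_rec_dyadic (mod_length W) sW fW ltW.
have p0 : 0 < 2 ^- n :> rat := pow2_gt0 n.
rewrite ltr_pM2r // ltr_nat => ab.
apply: (@lt_le_trans _ _ ((a.+1)%:R / 2 ^+ n)).
  rewrite -[a.+1]addn1 natrD mulrDl mul1r ltrD2l ltf_pV2 ?posrE ?exprn_gt0//.
  by rewrite ltr_eXn2l ?ltr1n.
by rewrite ler_pM2r // ler_nat.
Qed.

End GRMeasure.

Lemma direct_sum_projections (R : pzRingType) (A : lmodType R) (V W : set A)
    (sV : submodule V) (sW : submodule W) :
  V `&` W = [set 0] -> [set: A] = sum_set V W ->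
  exists (p : {linear A -> submod_type sV}) (q : {linear A -> submod_type sW}),
    [/\ forall x, submod_val sV (p x) + submod_val sW (q x) = x,
        forall v, p (submod_val sV v) = v & forall w, q (submod_val sW w) = w].
Proof.
move=> VW EA; have decomp x : exists vw : submod_type sV * submod_type sW,
    submod_val sV vw.1 + submod_val sW vw.2 = x.
  have : sum_set V W x by rewrite -EA.
  by move=> [v Vv [w Ww <-]]; exists (submod_in sV Vv, submod_in sW Ww).
have uniq (v v' : submod_type sV) (w w' : submod_type sW) :
    submod_val sV v + submod_val sW w = submod_val sV v' + submod_val sW w' ->
    v = v' /\ w = w'.
  move=> /eqP; rewrite -subr_eq0 opprD addrACA -!linearB addr_eq0 => /eqP E.
  have W0 : (V `&` W) (submod_val sW (w - w')).
    split; last exact: submod_valP.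
    by rewrite -[submod_val sW _]opprK -E; apply: submodN => //;
      exact: submod_valP.
  have w0 : submod_val sW (w - w') = 0 by move: W0; rewrite VW.
  have v0 : submod_val sV (v - v') = 0 by rewrite E w0 oppr0.
  split; apply/eqP; rewrite -subr_eq0; apply/eqP.
    by apply: (@submod_val_inj _ _ _ sV); rewrite v0 linear0.
  by apply: (@submod_val_inj _ _ _ sW); rewrite w0 linear0.
pose g x := projT1 (cid (decomp x)).
have gE x : submod_val sV (g x).1 + submod_val sW (g x).2 = x.
  by rewrite /g; case: cid.
have lg a x y : g (a *: x + y) = (a *: (g x).1 + (g y).1, a *: (g x).2 + (g y).2).
  have [] := uniq (g (a *: x + y)).1 (a *: (g x).1 + (g y).1)
    (g (a *: x + y)).2 (a *: (g x).2 + (g y).2).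
    by rewrite gE !linearP addrACA -scalerDr !gE.
  by case: (g _) => ? ? /= -> ->.
have lp : linear (fun x => (g x).1) by move=> a x y; rewrite lg.
have lq : linear (fun x => (g x).2) by move=> a x y; rewrite lg.
exists (linear_map lp), (linear_map lq); split=> // [v|w].
  have [|//] := uniq (g (submod_val sV v)).1 v (g (submod_val sV v)).2 0.
  by rewrite gE linear0 addr0.
have [|//] := uniq (g (submod_val sW w)).1 0 (g (submod_val sW w)).2 w.
by rewrite gE linear0 add0r.
Qed.

Definition mu (R : pzRingType) (M : lmodType R) : rat := gr_measure [set: M].

Section MainProperty.
Variable R : pzRingType.
Implicit Types X Y A B : lmodType R.

Lemma mu_submod A (V : set A) (sV : submodule V) : finite_length A ->
  mu (submod_type sV) = gr_measure V.
Proof.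
move=> fA; rewrite /mu -(gr_measure_image (f := submod_val sV)).
- by rewrite range_submod_val.
- exact: submod_val_inj.
- exact: submoduleT.
- exact: flT.
Qed.

Lemma len_submod A (V : set A) (sV : submodule V) : finite_length A ->
  len (submod_type sV) = mod_length V.
Proof.
move=> fA; rewrite /len -(len_inj (f := submod_val sV)).
- by rewrite range_submod_val.
- exact: submod_val_inj.
- exact: submoduleT.
- exact: flT.
Qed.

Lemma finite_length_submod A (V : set A) (sV : submodule V) :
  finite_length A -> finite_length (submod_type sV).
Proof. by apply: finite_length_inj; exact: submod_val_inj. Qed.

Lemma indecomposable_submod A (V : set A) (sV : submodule V) :
  indecomposable [set: submod_type sV] <-> indecomposable V.
Proof.
rewrite -[X in _ <-> indecomposable X](range_submod_val sV).
apply: iff_sym; apply: indecomposable_image; last exact: submoduleT.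
exact: submod_val_inj.
Qed.

Lemma mu_submod_le A (V : set A) : submodule V -> finite_length A ->
  gr_measure V <= mu A.
Proof.
move=> sV fA; apply: gr_measure_le => //; first exact: submoduleT.
Qed.

Lemma split_mono_surj X A (a : {linear X -> A}) : injective a ->
  range a = setT -> split_mono a.
Proof. by move=> inja ra; have [g [agK _]] := inverse_linear inja ra; exists g. Qed.

Lemma proper_submodT A (V : set A) : submodule V -> V <> setT ->
  proper_submodule V setT.
Proof.
move=> sV VT; split=> //; split=> // TV; apply: VT.
by apply/seteqP; split.
Qed.

Lemma split_mono_comp X A B (a : {linear X -> A}) (p : {linear A -> B}) :
  split_mono (p \o a) -> split_mono a.
Proof.
by move=> [r rK]; exists (linear_map (linearP (r \o p))) => x; exact: rK.
Qed.

(** Gabriel's main property for [X] embedded in [A * B], by induction on lengths. An injective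
    component is treated by decomposing its target. When neither is injective, both images are
    shorter than [X], and induction applies to a predecessor [V] of [X] mapping to these images;
    splitting is impossible there, so one image has measure above that of [V], and discreteness of
    the measure lifts this to [X]. *)
Lemma gr_main_property X A B (a : {linear X -> A}) (b : {linear X -> B}) :
  finite_length X -> finite_length A -> finite_length B ->
  indecomposable [set: X] -> (forall x, a x = 0 -> b x = 0 -> x = 0) ->
  [\/ mu X < mu A, mu X < mu B, split_mono a | split_mono b].
Proof.
have [n] := ubnP (maxn (len X + len A) (len X + len B))%N.
elim: n => // n IHn in X A B a b *; rewrite ltnS geq_max => /andP[leA leB].
move=> fX fA fB indX ab0.
(* An injective [a'] that is not onto has a proper image, which gives the strict inequality for
   indecomposable [A']. Otherwise [A'] is the direct sum of [V] and [W], and the two components of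
   [a'] fall under the induction hypothesis with shorter targets. *)
have injective_case (A' : lmodType R) (a' : {linear X -> A'}) :
    (len X + len A' <= n)%N -> finite_length A' -> injective a' ->
    mu X < mu A' \/ split_mono a'.
  move=> leA' fA' inja'.
  have [/(split_mono_surj inja')|nsurj] := pselect (range a' = setT).
    by right.
  have sR := submodule_range a'.
  have muX : mu X = gr_measure (range a').
    by rewrite gr_measure_image //; [exact: submoduleT | exact: flT].
  have pR := proper_submodT sR nsurj.
  have [iA'|nA'] := pselect (indecomposable [set: A']).
    left; rewrite muX; apply: lt_le_trans (gr_measure_proper_le _ _ pR).
    - by rewrite asboolT // ltrDl; exact: pow2_gt0.
    - exact: submoduleT.
    - exact: flT.
  have A'0 : [set: A'] <> [set 0].
    move=> A'0; apply: nsurj; apply/seteqP; split=> // x _.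
    have -> : x = 0 by have : [set: A'] x by []; rewrite A'0.
    exact: submod0 sR.
  have [V [W [pV pW VW EA _]]] := decomposableP (submoduleT A') A'0 nA'.
  have [[sV _] [sW _]] := (pV, pW).
  have [p [q [pqE _ _]]] := direct_sum_projections sV sW VW EA.
  have ltV := mod_length_lt (submoduleT A') fA' pV.
  have ltW := mod_length_lt (submoduleT A') fA' pW.
  have [|||||||||] := IHn X _ _ (linear_map (linearP (p \o a')))
    (linear_map (linearP (q \o a'))).
  - rewrite gtn_max !len_submod //.
    by rewrite !(leq_trans _ leA') // ltn_add2l.
  - by [].
  - exact: finite_length_submod.
  - exact: finite_length_submod.
  - by [].
  - move=> x /= px qx; apply: inja'; rewrite linear0 -(pqE (a' x)) px qx.
    by rewrite !linear0 addr0.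
  - rewrite mu_submod // => lt; left; apply: lt_le_trans lt _.
    exact: mu_submod_le.
  - rewrite mu_submod // => lt; left; apply: lt_le_trans lt _.
    exact: mu_submod_le.
  - by move=> /split_mono_comp; right.
  - by move=> /split_mono_comp; right.
have [inja|ninja] := pselect (injective a).
  by have [] := injective_case A a leA fA inja; [constructor 1 | constructor 3].
have [injb|ninjb] := pselect (injective b).
  by have [] := injective_case B b leB fB injb; [constructor 2 | constructor 4].
have range_lt (C : lmodType R) (c : {linear X -> C}) : ~ injective c ->
    (mod_length (range c) < len X)%N.
  move=> nc; apply: leq_trans (len_image_ker c (submoduleT X) fX).
  rewrite setTI -[X in (X < _)%N]add0n ltn_add2r.
  apply: mod_length_gt0; [exact: submodule_ker | exact: flT |].
  by move=> k0; apply: nc; apply: ker0_inj; rewrite k0.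
have [ltA ltB] := (range_lt _ _ ninja, range_lt _ _ ninjb).
have [V [pV muX V0]] := gr_predecessor (submoduleT X) fX indX.
have [sV [VX nXV]] := pV; have ltV := mod_length_lt (submoduleT X) fX pV.
have [sA sB] := (submodule_range a, submodule_range b).
(* [V] and the image are both shorter than [X], so by [gr_measure_gap] the difference of their
   measures exceeds [2^-|X|], which is exactly [mu X] minus the measure of [V]. *)
have gap (C : lmodType R) (c : {linear X -> C}) : finite_length C ->
    (mod_length (range c) < len X)%N -> gr_measure V < gr_measure (range c) ->
    mu X < mu C.
  move=> fC ltC lt; apply: (@lt_le_trans _ _ (gr_measure (range c))).
    rewrite /mu muX; apply: gr_measure_gap => //; try exact: flT.
    exact: submodule_range.
  by apply: mu_submod_le => //; exact: submodule_range.
case: V0 => [V0|iV].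
  (* With a zero predecessor, positive measure of the image of [a] is enough; that image is nonzero,
     for otherwise [b] would be injective. *)
  constructor 1; apply: (gap A a) => //; rewrite V0 gr_measure0.
  apply: lt_le_trans (pow2_gt0 _) (gr_measure_ge sA _ _); first exact: flT.
  move=> A0; apply: ninjb; apply: ker0_inj => x bx; apply: ab0 => //.
  have : range a (a x) by exists x.
  by rewrite A0.
have corestrict (C : lmodType R) (c : {linear X -> C}) :
    exists c' : {linear X -> submod_type (submodule_range c)},
      forall x, submod_val _ (c' x) = c x.
  by apply: linear_corestrict => x; exists x.
have [a' a'E] := corestrict _ a; have [b' b'E] := corestrict _ b.
(* A retraction would make [rho] an idempotent of [X] with image [V], so [V] would be a nonzero
   proper direct summand of the indecomposable [X]. *)
have not_split (C : lmodType R) (c : {linear X -> C}) :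
    ~ split_mono (c \o submod_val sV).
  move=> [r rK]; apply: nXV.
  have [rho rhoE] : exists rho : {linear X -> X},
      forall x, rho x = submod_val sV (r (c x)).
    by exists (linear_map (linearP (submod_val sV \o (r \o c)))).
  have rhoV x : V (rho x) by rewrite rhoE; exact: submod_valP.
  have rhoK x : V x -> rho x = x.
    move=> Vx; rewrite rhoE.
    exact: (congr1 (submod_val sV) (rK (submod_in sV Vx))).
  have kerB x : ker rho (x - rho x).
    by have : rho (x - rho x) = 0 by rewrite linearB (rhoK (rho x)) // subrr.
  have [||||V0|K0] := indX.2 V (ker rho) sV (submodule_ker rho).
  - by [].
  - by [].
  - apply/seteqP; split=> [x [Vx kx]|_ ->]; first by rewrite -(rhoK x Vx).
    by split; [exact: submod0 | exact: submod0 (submodule_ker rho)].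
  - apply/seteqP; split=> // x _; exists (rho x) => //.
    by exists (x - rho x); last by rewrite subrKC.
  - by case: iV.
  - by move=> x _; have := kerB x; rewrite K0 => /eqP; rewrite subr_eq0 => /eqP ->.
have [|||||||||] := IHn _ _ _ (linear_map (linearP (a' \o submod_val sV)))
  (linear_map (linearP (b' \o submod_val sV))).
- rewrite gtn_max !len_submod //; apply/andP; split.
    apply: leq_trans leA; 
      apply: leq_trans (_ : _ < len X + mod_length (range a))%N _.
      by rewrite ltn_add2r.
    by rewrite leq_add2l; apply: len_le => //; exact: submoduleT.
  apply: leq_trans leB; 
    apply: leq_trans (_ : _ < len X + mod_length (range b))%N _.
    by rewrite ltn_add2r.
  by rewrite leq_add2l; apply: len_le => //; exact: submoduleT.
- exact: finite_length_submod.
- exact: finite_length_submod.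
- exact: finite_length_submod.
- exact/indecomposable_submod.
- move=> x /= ax bx; apply: (@submod_val_inj _ _ _ sV); rewrite linear0.
  by apply: ab0; [rewrite -a'E ax | rewrite -b'E bx]; rewrite linear0.
- by rewrite !mu_submod // => lt; constructor 1; exact: gap fA ltA lt.
- by rewrite !mu_submod // => lt; constructor 2; exact: gap fB ltB lt.
- by move=> /not_split.
- by move=> /not_split.
Qed.

End MainProperty.

(** * Gabriel-Roiter inclusions *)

Section GRInclusion.
Variables (R : pzRingType) (X Y : lmodType R) (i : {linear X -> Y}).
Hypotheses (fX : finite_length X) (fY : finite_length Y) (gri : gr_inclusion i).

Let sR := submodule_range i.

Lemma gr_inclusion_source_indecomposable : indecomposable [set: X].
Proof.
have [inji [_ _ _ indR _]] := gri.
exact/(indecomposable_image inji (submoduleT X)).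
Qed.

Lemma mu_gr_inclusion : mu X = gr_measure (range i).
Proof.
have [inji _] := gri.
by rewrite gr_measure_image //; [exact: submoduleT | exact: flT].
Qed.

Lemma gr_measure_le_gr_inclusion (W : set Y) :
  proper_submodule W setT -> gr_measure W <= mu X.
Proof.
move=> pW; have [_ [indY _ _ _ E]] := gri.
have := gr_measure_proper_le (submoduleT Y) (flT _ fY) pW.
by rewrite asboolT // -E -mu_gr_inclusion addrCA gerDl subr_le0.
Qed.

Lemma len_gr_inclusion : (len X < len Y)%N.
Proof.
have [inji [_ _ pR _ _]] := gri.
rewrite /len -(len_inj inji); [|exact: submoduleT|exact: flT].
by apply: mod_length_lt pR; [exact: submoduleT | exact: flT].
Qed.

Lemma gr_inclusion_not_split : ~ split_mono i.
Proof.
move=> [r rK]; have [_ [indY _ [_ [_ nYR]] indR _]] := gri.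
have kerB y : ker r (y - i (r y)).
  by have : r (y - i (r y)) = 0 by rewrite linearB rK subrr.
have [||||R0|K0] := indY.2 (range i) (ker r) sR (submodule_ker r).
- by [].
- by [].
- apply/seteqP; split=> [_ [[x _ <-] rx]|_ ->].
    by have : r (i x) = 0 by []; rewrite rK => ->; rewrite linear0.
  by split; [exact: submod0 sR | exact: submod0 (submodule_ker r)].
- apply/seteqP; split=> // y _; exists (i (r y)); first by exists (r y).
  by exists (y - i (r y)); last by rewrite subrKC.
- by case: indR.
- apply: nYR => y _; have := kerB y; rewrite K0 => /eqP.
  by rewrite subr_eq0 => /eqP ->; exists (r y).
Qed.

(** An injective sum embeds [X] into the product of the two images. These are proper in [Y], being
    no longer than [X], so their measures are at most [mu X], and the main property leaves only a
    split component, which is injective. *)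
Lemma injective_sum_gr_inclusion (u v : {linear X -> Y}) :
  injective (u \+ v) -> injective u \/ injective v.
Proof.
move=> inj; apply: contrapT => /not_orP[nu nv].
have corestrict (w : {linear X -> Y}) :
    exists w' : {linear X -> submod_type (submodule_range w)},
      forall x, submod_val _ (w' x) = w x.
  by apply: linear_corestrict => x; exists x.
have not_gt (w : {linear X -> Y}) :
    ~ (mu X < mu (submod_type (submodule_range w))).
  rewrite mu_submod // => lt; have : gr_measure (range w) <= mu X.
    apply: gr_measure_le_gr_inclusion.
    apply: (proper_submodT (submodule_range w)) => wT.
    have := len_image w (submoduleT X) fX; rewrite wT leqNgt.
    by rewrite -/(len X) len_gr_inclusion.
  by rewrite leNgt lt.
have [u' uE] := corestrict u; have [v' vE] := corestrict v.
have [|||||||] := gr_main_property (a := u') (b := v') fX.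
- exact: finite_length_submod.
- exact: finite_length_submod.
- exact: gr_inclusion_source_indecomposable.
- move=> x ux vx; apply: inj; rewrite /= -uE -vE ux vx.
  by rewrite !linear0 addr0.
- exact: not_gt.
- exact: not_gt.
- move=> [r rK]; apply: nu => x y xy; rewrite -(rK x) -(rK y); congr (r _).
  by apply: (@submod_val_inj _ _ _ (submodule_range u)); rewrite !uE.
- move=> [r rK]; apply: nv => x y xy; rewrite -(rK x) -(rK y); congr (r _).
  by apply: (@submod_val_inj _ _ _ (submodule_range v)); rewrite !vE.
Qed.

(** If [range g] were proper, its measure would be at most [mu X]. The main property, with both maps
    equal to the embedding of [X] into [range g], would then split this embedding, and so [f]. *)
Lemma surjective_of_nonsplit_factor (M : lmodType R) (f : {linear X -> M})
    (g : {linear M -> Y}) :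
  injective (g \o f) -> ~ split_mono f -> range g = setT.
Proof.
move=> injgf nsplit; apply: contrapT => nsurj.
have sg := submodule_range g.
have [g' gE] : exists g' : {linear M -> submod_type sg},
    forall x, submod_val sg (g' x) = g x.
  by apply: linear_corestrict => x; exists x.
have le := gr_measure_le_gr_inclusion (proper_submodT sg nsurj).
have ngt : ~ (mu X < mu (submod_type sg)).
  by rewrite mu_submod // => lt; move: le; rewrite leNgt lt.
have gf0 x : (g' \o f) x = 0 -> x = 0.
  by move=> gx; apply: injgf; rewrite linear0 /= -gE [g' _]gx linear0.
have fg := finite_length_submod sg fY.
have [] // := gr_main_property (a := linear_map (linearP (g' \o f)))
  (b := linear_map (linearP (g' \o f))) fX fg fg gr_inclusion_source_indecomposable.
- by move=> x gx _; exact: gf0.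
- by move=> /split_mono_comp.
- by move=> /split_mono_comp.
Qed.

Lemma gr_inclusion_injective (j : {linear X -> Y}) :
  injective j -> gr_inclusion j.
Proof.
move=> injj; have [inji [indY nsY _ _ E]] := gri.
split=> //; split=> //.
- apply: proper_submodT; first exact: submodule_range.
  move=> jT; have := len_gr_inclusion.
  by rewrite /len -jT (len_inj injj) ?ltnn; [|exact: submoduleT|exact: flT].
- apply/(indecomposable_image injj (submoduleT X)).
  exact: gr_inclusion_source_indecomposable.
- rewrite (gr_measure_image injj); [|exact: submoduleT|exact: flT].
  by rewrite -/(mu X) mu_gr_inclusion.
Qed.

End GRInclusion.

(** * Minimal left almost split maps and their indecomposable summands *)

Lemma split_mono_compl (R : pzRingType) (X M Z : lmodType R)
  (f : {linear X -> M}) (e : {linear X -> Z}) (p : {linear Z -> M}) :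
  (forall x, p (e x) = f x) -> split_mono f -> split_mono e.
Proof.
move=> pe [r rK]; exists (linear_map (linearP (r \o p))) => x /=.
by rewrite pe rK.
Qed.

(** The image of [phi] contains that of [e], and [e] stays left almost split when its target is cut
    down to it. Minimal length of [E] thus makes [phi] onto, hence injective. *)
Lemma minimal_left_almost_split (R : pzRingType) (X : lmodType R) :
  (exists (E : lmodType R) (e : {linear X -> E}),
    finite_length E /\ left_almost_split e) ->
  exists (E : lmodType R) (e : {linear X -> E}),
    [/\ finite_length E, left_almost_split e &
        forall phi : {linear E -> E}, (forall x, phi (e x) = e x) ->
          injective phi /\ range phi = setT].
Proof.
move=> [E0 [e0 [fE0 lase0]]].
have exE : exists n, `[< exists (E : lmodType R) (e : {linear X -> E}),
    [/\ finite_length E, left_almost_split e & len E = n] >].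
  by exists (len E0); apply/asboolP; exists E0, e0.
case: (ex_minnP exE) => n /asboolP[E [e [fE lase En]]] minn.
exists E, e; split=> // phi phie.
have sp := submodule_range phi.
have fT := finite_length_submod sp fE.
have [e' e'E] : exists e' : {linear X -> submod_type sp},
    forall x, submod_val sp (e' x) = e x.
  by apply: linear_corestrict => x; exists (e x).
have [p pE] : exists p : {linear E -> submod_type sp},
    forall y, submod_val sp (p y) = phi y.
  by apply: linear_corestrict => y; exists y.
have pe x : p (e x) = e' x.
  by apply: (@submod_val_inj _ _ _ sp); rewrite pE e'E.
have surj : range phi = setT.
  rewrite -(range_submod_val sp).
  apply: (len_inj_eq (@submod_val_inj _ _ _ sp)) => //.
  rewrite En; apply: minn; apply/asboolP; exists (submod_type sp), e'; split=> //.
  split; first by move=> /(split_mono_compl pe); exact: lase.1.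
  move=> Z f fZ nf; have [h hE] := lase.2 Z f fZ nf.
  exists (linear_map (linearP (h \o submod_val sp))) => x.
  by rewrite -[LHS]/(h (submod_val sp (e' x))) e'E.
by split=> //; exact: len_surj_eq.
Qed.

Theorem theoremA (k : comPzRingType) (L : algType k)
    (X Y : lmodType L) (i : {linear X -> Y}) :
  artin_algebra L -> finite_length X -> finite_length Y -> gr_inclusion i ->
  exists (M : lmodType L) (f : {linear X -> M}) (g : {linear M -> Y}),
    [/\ finite_length M,
        indecomposable [set: M],
        injective f /\ irreducible_map f,
        range g = [set: Y] &
        injective (g \o f) /\ gr_inclusion (g \o f)].
Proof.
move=> [artk fgL] fX fY gri.
have fk := artinian_finite_length artk.
have fL := algebra_finite_length fk fgL.
have indX := gr_inclusion_source_indecomposable gri.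
have [J dJ] := dualizing_exists fk.
have [E [e [fE [nse lase] mine]]] :=
  minimal_left_almost_split (left_almost_split_exists fk fL dJ fX indX).
have [h hE] := lase Y i fY (gr_inclusion_not_split gri).
have inji := gri.1.
pose retracts : set (set E) := [set N | exists p : {linear E -> E},
  [/\ range p = N, forall y, p (p y) = p y & injective (h \o (p \o e))]].
have [|N [p [<- pp injp]] minp] := @exists_min_len _ _ retracts.
  exists setT, (linear_map (linearP (@idfun E))); split=> //.
    by apply/seteqP; split=> // y _; exists y.
  by move=> x y /=; rewrite !hE; exact: inji.
have sM := submodule_range p; pose M := submod_type sM.
have fM : finite_length M := finite_length_submod sM fE.
have [pi piE] : exists pi : {linear E -> M}, forall y, submod_val sM (pi y) = p y.
  by apply: linear_corestrict => y; exists y.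
have piK (m : M) : pi (submod_val sM m) = m.
  apply: (@submod_val_inj _ _ _ sM); rewrite piE.
  by have [y _ <-] := submod_valP m; rewrite pp.
have [f fE'] : exists f : {linear X -> M}, forall x, f x = pi (e x).
  by exists (linear_map (linearP (pi \o e))).
have [g gE] : exists g : {linear M -> Y}, forall m, g m = h (submod_val sM m).
  by exists (linear_map (linearP (h \o submod_val sM))).
have injgf : injective (g \o f).
  by move=> x y /=; rewrite !gE !fE' !piE; exact: injp.
have injf : injective f := inj_compr injgf.
have nsf : ~ split_mono f.
  by move=> /(split_mono_compl (e := e) (p := pi) (fun x => esym (fE' x))).
exists M, f, g; split=> //.
- apply: contrapT => nind.
  have M0 : [set: M] <> [set 0].
    move=> M0; apply: indX.1; apply/seteqP; split=> // x _; apply: injf.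
    have : [set: M] (f x) by [].
    by rewrite M0 linear0.
  have [V [W [pV pW VW EM _]]] := decomposableP (submoduleT M) M0 nind.
  (* A proper summand [A] of [M] through which the composite stays injective would give an
     idempotent [p'] of [E] with smaller image, against minimality. But the composites for the two
     summands of [M] add up to [g \o f], so one of them is injective. *)
  have component A (sA : submodule A) (q : {linear M -> submod_type sA}) :
      proper_submodule A [set: M] -> (forall v, q (submod_val sA v) = v) ->
      ~ injective (g \o (submod_val sA \o (q \o f))).
    move=> pA qK inj.
    pose p' := linear_map (linearP (submod_val sM \o (submod_val sA \o (q \o pi)))).
    have rp' : range p' = submod_val sM @` A.
      apply/seteqP; split=> [_ [y _ <-]|_ [m Am <-]].
        by exists (submod_val sA (q (pi y))) => //; exact: submod_valP.
      exists (submod_val sM m) => //=; rewrite piK.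
      by rewrite -[m in q m](submod_inK sA Am) qK.
    have : (mod_length (range p) <= mod_length (range p'))%N.
      apply: minp; exists p'; split=> // [y|x y xy].
        by rewrite /= piK qK.
      by apply: inj; move: xy; rewrite /= !gE !fE'.
    rewrite rp' (len_inj (@submod_val_inj _ _ _ sM) sA); last exact: flT.
    rewrite -(len_submod sM fE) leqNgt (mod_length_lt _ _ pA) //.
    exact: submoduleT.
  have [[sV _] [sW _]] := (pV, pW).
  have [q [r [qr qK rK]]] := direct_sum_projections sV sW VW EM.
  have [||] := injective_sum_gr_inclusion fX fY gri
    (u := linear_map (linearP (g \o (submod_val sV \o (q \o f)))))
    (v := linear_map (linearP (g \o (submod_val sW \o (r \o f))))).
  + by move=> x y /=; rewrite -!linearD !qr; exact: injgf.
  + exact: component pV qK.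
  + exact: component pW rK.
- split=> //; split=> //.
    move=> [s sK]; apply: nsf; apply: split_mono_surj => //.
    by apply/seteqP; split=> // m _; exists (s m).
  move=> Z h' h'' fZ fh; have [|nsh'] := pselect (split_mono h').
    by left.
  right.
  have [w wE] := lase Z h' fZ nsh'.
  (* [phi] adds to [h'' \o w] the projection [y - p y] onto the complement of [M]. Since
     [h'' \o w \o e = f], it fixes [e] and is bijective by minimality; projecting [phi \o psi = id]
     to [M] shows that [w \o psi] restricted to [M] is a section of [h'']. *)
  have [phi phiE] : exists phi : {linear E -> E},
      forall y, phi y = submod_val sM (h'' (w y)) + (y - p y).
    pose phi := (submod_val sM \o (h'' \o w)) \+ (idfun \- p).
    by exists (linear_map (linearP phi)).
  have [|injphi surjphi] := mine phi.
    move=> x; rewrite phiE wE -[h'' _]/((h'' \o h') x) -fh fE' piE.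
    by rewrite addrC subrK.
  have [psi [_ psiK]] := inverse_linear injphi surjphi.
  exists (linear_map (linearP (w \o (psi \o submod_val sM)))) => m /=.
  have := congr1 pi (psiK (submod_val sM m)); rewrite phiE piK linearD linearB piK.
  have -> : pi (p (psi (submod_val sM m))) = pi (psi (submod_val sM m)).
    by apply: (@submod_val_inj _ _ _ sM); rewrite !piE pp.
  by rewrite subrr addr0.
- exact: (surjective_of_nonsplit_factor fX fY gri injgf nsf).
- by split=> //; exact: (gr_inclusion_injective fY gri injgf).
Qed.
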